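(* Let $D\subset\mathbb{R}^d$ be a bounded Lebesgue measurable domain with $0<\mathrm{Leb}(D)<\infty$, with normalized Lebesgue measure $\nu(B)=\mathrm{Leb}(B)/\mathrm{Leb}(D)$. Let $\mathcal{A}$ and $\mathcal{U}$ be separable Banach spaces whose elements are measurable functions $D\to\mathbb{R}^{d_a}$ and $D\to\mathbb{R}^{d_u}$ respectively, with their Borel sigma algebras. Let $\mathcal{G}^\dagger,\hat{\mathcal{G}}:\mathcal{A}\to\mathcal{U}$ and $\hat{\mathcal{E}}:\mathcal{A}\to\mathcal{U}(D;\mathbb{R})$ be Borel measurable operators admitting product-measurable representatives, with $\hat{\mathcal{E}}(a)\ge 0$ $\nu$-a.e. for every $a\in\mathcal{A}$. Let $\mu$ be a Borel probability measure on $\mathcal{A}$, let $\alpha,\gamma\in(0,1)$, $n\ge1$, and $k=\lceil(1-\alpha)(n+1)\rceil$. Suppose that $A_1,\dots,A_{n+1}$ are exchangeable $\mathcal{A}$-valued random variables with common law $\mu$. Let $\hat\lambda$ be the $k$th smallest value of $s(A_1),\dots,s(A_n)$ if $k\le n$, and $\hat\lambda=\infty$ otherwise. Then $$\mathbb{P}\Bigl(\nu\bigl(\{x\in D:\mathcal{G}^\dagger(A_{n+1})(x)\in C_{\hat\lambda}(A_{n+1})(x)\}\bigr)\ge 1-\gamma\Bigr)\ \ge\ \frac{k}{n+1}\ \ge\ 1-\alpha .$$ Moreover, if the $A_i$ are i.i.d. and the distribution of $s(A_1)$ is atomless, then the random variable $\mathbb{P}\bigl(w_{\hat\lambda}(A_{n+1})\ge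 1-\gamma\mid A_1,\dots,A_n\bigr)$ follows a $\mathrm{Beta}(k,n+1-k)$ distribution and $$\mathbb{P}\Bigl(\nu\bigl(\{x\in D:\mathcal{G}^\dagger(A_{n+1})(x)\in C_{\hat\lambda}(A_{n+1})(x)\}\bigr)\ge 1-\gamma\Bigr)=\frac{k}{n+1}\ \le\ 1-\alpha+\frac1{n+1}.$$
   Context: $\mathcal{U}(D;\mathbb{R})$ denotes the corresponding space of scalar-valued functions; elements of the function spaces are defined up to $\nu$-a.e. equality. Standing assumption: there are $\mathcal{B}(\mathcal{A})\otimes\mathcal{B}(D)$-measurable maps $g^\dagger,\hat g:\mathcal{A}\times D\to\mathbb{R}^{d_u}$ and $\hat e:\mathcal{A}\times D\to[0,\infty)$ (product-measurable representatives) such that for every $a$, $g^\dagger(a,\cdot)$, $\hat g(a,\cdot)$, $\hat e(a,\cdot)$ are representatives of $\mathcal{G}^\dagger(a)$, $\hat{\mathcal{G}}(a)$, $\hat{\mathcal{E}}(a)$; one fixed such choice is used, and $\mathcal{G}^\dagger(a)(x)$, $\hat{\mathcal{G}}(a)(x)$, $\hat{\mathcal{E}}(a)(x)$ mean $g^\dagger(a,x)$, $\hat g(a,x)$, $\hat e(a,x)$. Prediction band: for $\lambda\in[0,\infty)$, $C_\lambda(a)(x)=\{y\in\mathbb{R}^{d_u}:\|y-\hat{\mathcal{G}}(a)(x)\|_2\le\lambda\,\hat{\mathcal{E}}(a)(x)\}$, and $C_\infty(a)(x)=\mathbb{R}^{d_u}$. Residual field: $\rho(a,x)=\|\mathcal{G}^\dagger(a)(x)-\hat{\mathcal{G}}(a)(x)\|_2/\hat{\mathcal{E}}(a)(x)\in[0,\infty]$,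 where, if $\hat{\mathcal{E}}(a)(x)=0$, $\rho(a,x)=0$ when $\mathcal{G}^\dagger(a)(x)=\hat{\mathcal{G}}(a)(x)$ and $\rho(a,x)=\infty$ otherwise. Containment fraction and score: $w_\lambda(a)=\nu(\{x\in D:\rho(a,x)\le\lambda\})$ for $\lambda\in[0,\infty]$, and $s(a)=\inf\{\lambda\ge0:w_\lambda(a)\ge1-\gamma\}$ with $\inf\emptyset=+\infty$. Order statistics are counted with multiplicity. *)

(* Defs.v *)
From HB Require Import structures.
From mathcomp Require Import all_boot all_order all_algebra.
From mathcomp Require Import perm.
From mathcomp Require Import all_classical all_reals all_analysis.

Set Implicit Arguments.
Unset Strict Implicit.
Unset Printing Implicit Defensive.

Import Order.TTheory GRing.Theory Num.Theory.
Import numFieldNormedType.Exports.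

Local Open Scope classical_set_scope.
Local Open Scope ring_scope.
Local Open Scope ereal_scope.

Notation borel T := (g_sigma_algebraType (@open T)).

(* The norm of the library on 'rV is the sup norm. *)
Definition norm2 (R : realType) m (v : 'rV[R]_m) : R :=
  Num.sqrt (\sum_(i < m) v ord0 i ^+ 2)%R.

Section lebesgue.
Context (R : realType) (d : nat).

(* p encodes the half-open box \prod_i ]p.1 i, p.2 i], possibly empty. *)
Definition box (p : 'rV[R]_d * 'rV[R]_d) : set 'rV[R]_d :=
  [set x | forall i, (p.1 ord0 i < x ord0 i <= p.2 ord0 i)%R].

Definition box_volume (p : 'rV[R]_d * 'rV[R]_d) : R :=
  (\prod_(i < d) Num.max 0 (p.2 ord0 i - p.1 ord0 i))%R.

(* Lebesgue outer measure. The Lebesgue measurable sets are the sets in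
   leb.-caratheodory, and leb restricted to them is the Lebesgue measure. *)
Definition leb (S : set 'rV[R]_d) : \bar R :=
  ereal_inf [set \esum_(p in C) (box_volume p)%:E |
    C in [set C | countable C /\ S `<=` \bigcup_(p in C) box p]].

Lemma leb_set0 : leb set0 = 0.
Proof.
apply/eqP; rewrite eq_le; apply/andP; split.
  by apply: ereal_inf_lbound; exists set0; [split|rewrite esum_set0].
apply: le_ereal_inf_tmp => _ [C _ <-]; apply: esum_ge0 => p _.
by rewrite lee_fin prodr_ge0// => i _; rewrite le_max lexx.
Qed.

End lebesgue.

Record domain (R : realType) (d : nat) := Domain {
  domain_set :> set 'rV[R]_d ;
  domain_bounded : bounded_set domain_set ;
  domain_measurable : (@leb R d).-caratheodory domain_set ;
  domain_gt0 : 0 < leb domain_set ;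
  domain_lty : leb domain_set < +oo }.

(* D as a type, with its Borel sigma-algebra, which is the trace of that of
   R^d. Measurable types have to be pointed; the choice of the point is
   irrelevant. *)
Section points.
Context (R : realType) (d : nat) (D : domain R d).

Definition points : Type := set_type D.

HB.instance Definition _ := Choice.on points.

Lemma points_inhabited : exists x : points, True.
Proof.
apply: contrapT => D0; have := domain_gt0 D.
suff -> : domain_set D = set0 by rewrite leb_set0 ltxx.
by rewrite -subset0 => x Dx; apply: D0; exists (exist _ x (mem_set Dx)).
Qed.

HB.instance Definition _ := isPointed.Build points (projT1 (cid points_inhabited)).

Definition coords (x : points) : borel 'rV[R]_d := set_val x.

HB.instance Definition _ :=
  Measurable.copy points (g_sigma_algebra_preimageType coords).

Definition nu (B : set points) : \bar R :=
  leb (coords @` B) * (fine (leb D))^-1%:E.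

End points.

(* A separable Banach space whose elements are nu-a.e. classes of measurable
   functions D -> V: fun_of f is a chosen Borel member of the class f (every
   Lebesgue measurable function agrees a.e. with a Borel one). *)
Record function_space (R : realType) (d : nat) (D : domain R d)
    (V : normedModType R) := FunctionSpace {
  fs_carrier :> completeNormedModType R ;
  fs_separable : exists2 S : set fs_carrier, countable S & dense S ;
  fun_of : fs_carrier -> points D -> V ;
  fun_of_measurable : forall f,
    measurable_fun [set: points D] (fun_of f : points D -> borel V) ;
  fun_of_linear : forall (c : R) (f g : fs_carrier), \forall x \ae @nu R d D,
    fun_of (c *: f + g)%R x = (c *: fun_of f x + fun_of g x)%R ;
  fun_of_inj : forall f g : fs_carrier,
    (\forall x \ae @nu R d D, fun_of f x = fun_of g x) -> f = g }.

Definition represents (R : realType) (d : nat) (D : domain R d)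
    (V : normedModType R) (E : function_space D V) (u : points D -> V) (f : E) :=
  \forall x \ae @nu R d D, u x = fun_of f x.

Section band.
Context (R : realType) (d m : nat) (D : domain R d) (A : Type).
(* g is the truth, gh the prediction and eh the error estimate. *)
Variables (g gh : A * points D -> 'rV[R]_m) (eh : A * points D -> R).
Variable gamma : R.

Definition band (lambda : \bar R) (a : A) (x : points D) : set 'rV[R]_m :=
  match lambda with
  | l%:E => [set y | (norm2 (y - gh (a, x)) <= l * eh (a, x))%R]
  | +oo => setT
  | -oo => set0
  end.

Definition residual (a : A) (x : points D) : \bar R :=
  if eh (a, x) == 0%R then (if g (a, x) == gh (a, x) then 0 else +oo)
  else (norm2 (g (a, x) - gh (a, x)) / eh (a, x))%:E.

Definition containment (lambda : \bar R) (a : A) : \bar R :=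
  nu [set x | residual a x <= lambda].

Definition score (a : A) : \bar R :=
  ereal_inf [set l%:E | l in
    [set l : R | (0 <= l)%R /\ (1 - gamma)%:E <= containment l%:E a]].

Definition coverage (lambda : \bar R) (a : A) : \bar R :=
  nu [set x | band lambda a x (g (a, x))].

End band.

(* k is counted from 1. *)
Definition kth_smallest (R : realType) (k : nat) (s : seq (\bar R)) : \bar R :=
  nth +oo (sort <=%O s) k.-1.

(* Of the n.+1 scores, all but the last one are used. *)
Definition threshold (R : realType) (n k : nat) (s : 'I_n.+1 -> \bar R) :
    \bar R :=
  if (k <= n)%N
  then kth_smallest k [seq s (widen_ord (leqnSn n) i) | i <- enum 'I_n]
  else +oo.

Section probability.
Context (dO : measure_display) (Omega : measurableType dO) (R : realType).
Variable P : probability Omega R.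

Definition exchangeable (dT : measure_display) (T : measurableType dT) (n : nat)
    (X : 'I_n -> Omega -> T) :=
  forall (s : {perm 'I_n}) (B : set (n.-tuple T)), measurable B ->
    P [set w | B [tuple X (s i) w | i < n]] = P [set w | B [tuple X i w | i < n]].

Definition mutually_independent (dT : measure_display) (T : measurableType dT)
    (n : nat) (X : 'I_n -> Omega -> T) :=
  forall (J : {set 'I_n}) (B : 'I_n -> set T), (forall i, measurable (B i)) ->
    P (\bigcap_(i in [set` J]) X i @^-1` B i) =
    \big[*%E/1]_(i in J) P (X i @^-1` B i).

(* Z is a version of the conditional probability of E given the
   sub-sigma-algebra G. *)
Definition is_cond_prob (E : set Omega) (G : set (set Omega)) (Z : Omega -> R) :=
  [/\ forall B : set R, measurable B -> G (Z @^-1` B),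
      P.-integrable [set: Omega] (EFin \o Z) &
      forall F, G F -> \int[P]_(w in F) (Z w)%:E = P (E `&` F)].

Definition atomless_law (Y : Omega -> \bar R) :=
  forall t : \bar R, P (Y @^-1` [set t]) = 0.

End probability.

(* Beta(a, b) for integers a > 0 and b >= 0. Beta(a, 0) is the limiting case,
   the point mass at 1; beta_prob a 0 is Beta(a, 1) instead. *)
Definition beta_law (R : realType) (a b : nat) (B : set R) : \bar R :=
  if b == 0%N then \d_(1%R : R) B else beta_prob a b B.

(* Main.v *)
(* The infimum defining the score is attained, so the coverage event is
   {s(A_{n+1}) <= lambda_hat}, i.e. fewer than k of the n+1 scores are strictly
   below the last one. At least k indices have this property and, when there
   are no ties, at most k; by exchangeability all indices are equally likely.

   In the i.i.d. case, Fubini gives the conditional probability F(lambda_hat),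
   where F is the distribution function of the score. Since F is continuous,
   {F <= t} is the half-line below the t-quantile c, so F(lambda_hat) <= t iff at
   least k of the first n scores are <= c. This is a binomial tail of parameter
   t, a polynomial whose derivative telescopes to the Beta(k, n+1-k) density. *)

Require Import Defs.
From HB Require Import structures.
From mathcomp Require Import all_boot all_order all_algebra.
From mathcomp Require Import all_classical all_reals all_analysis.
From mathcomp Require Import measurable_realfun perm lra.

Set Implicit Arguments.
Unset Strict Implicit.
Unset Printing Implicit Defensive.

Import Order.TTheory GRing.Theory Num.Theory.
Import numFieldNormedType.Exports.

Local Open Scope classical_set_scope.
Local Open Scope ring_scope.
Local Open Scope ereal_scope.

(** * Lebesgue measure on the domain *)

(** Lebesgue measure enters as an outer measure defined by covers, so [nu] must first be shown to be
    a probability. The outer measure of a box is never computed: Carathéodory's theorem supplies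
    additivity, the normalization supplies total mass 1, and the only geometric input is that a
    hyperplane cuts a box into two boxes whose volumes add up.

    The Beta law is asserted for every version of the conditional probability. It is computed for
    one explicit version, and almost sure uniqueness carries it to the others.

    The exact coverage k/(n+1) is not obtained as the mean of the Beta law. Counting indices bounds
    the probability of a small weak rank from above, and it remains to see that ties with the last
    score are null; this too comes from conditioning on the first n variables.

    If k = n+1, the threshold is infinite and the conditional probability is constantly 1, which is
    the degenerate case of [beta_law]. *)

Lemma esum_subset (R : realType) (T : choiceType) (I J : set T) (a : T -> \bar R) :
  I `<=` J -> (forall i, J i -> 0 <= a i) ->
  \esum_(i in I) a i <= \esum_(i in J) a i.
Proof.
move=> IJ a0; apply: ge_ereal_sup => _ [X [finX XI] <-].
by apply: ereal_sup_ubound; exists X => //; split=> // x /XI /IJ.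
Qed.

(** The map [e] may identify indices. A section [g] picks one preimage per value, and the sum over
    these representatives is part of the sum over [I]. *)
Lemma esum_image_le (R : realType) (T T' : pointedType) (I : set T)
    (e : T -> T') (a : T' -> \bar R) : (forall y, 0 <= a y) ->
  \esum_(j in e @` I) a j <= \esum_(i in I) a (e i).
Proof.
move=> a0; have /choice[g gP] : forall y, exists x, (e @` I) y -> I x /\ e x = y.
  by move=> y; have [[x Ix <-]|?] := pselect ((e @` I) y); [exists x|exists point].
have -> : \esum_(j in e @` I) a j = \esum_(i in g @` (e @` I)) a (e i).
  rewrite (esum_image _ g).
    by apply: eq_esum => y /gP[_ ->].
  by move=> x y /set_mem/gP[_ {2}<-] /set_mem/gP[_ {2}<-] ->.
apply: esum_subset => [_ [y yI <-]|//]; exact: (gP _ yI).1.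
Qed.

Section lebesgue_outer_measure.
Context (R : realType) (d : nat).
Implicit Types p : 'rV[R]_d * 'rV[R]_d.

Lemma box_volume_ge0 p : (0 <= box_volume p)%R.
Proof. by rewrite prodr_ge0// => i _; rewrite le_max lexx. Qed.

Lemma leb_ge0 (S : set 'rV[R]_d) : 0 <= leb S.
Proof.
apply: le_ereal_inf_tmp => _ [C _ <-]; apply: esum_ge0 => p _.
by rewrite lee_fin box_volume_ge0.
Qed.

(** Covers in [leb] are sets of boxes; this admits indexed families, where a repeated box only
    increases the right-hand side. *)
Lemma leb_le_cover (T : pointedType) (I : set T) (e : T -> 'rV[R]_d * 'rV[R]_d)
    (S : set 'rV[R]_d) : countable I -> S `<=` \bigcup_(i in I) box (e i) ->
  leb S <= \esum_(i in I) (box_volume (e i))%:E.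
Proof.
move=> cI SI; apply: (le_trans _ (@esum_image_le R _ _ I e
  (fun p => (box_volume p)%:E) _)); last by move=> p; rewrite lee_fin box_volume_ge0.
apply: ereal_inf_lbound; exists (e @` I) => //; split.
  by apply: sub_countable cI; exact: card_image_le.
by rewrite bigcup_image.
Qed.

Lemma le_leb : {homo @leb R d : S S' / S `<=` S' >-> S <= S'}.
Proof.
move=> S S' SS'; apply: ereal_inf_le_tmp => _ [C [cC S'C] <-].
by exists C => //; split=> //; exact: subset_trans S'C.
Qed.

Lemma leb_sigma_subadditive : sigma_subadditive (@leb R d).
Proof.
(* A near-optimal cover exists only where the infimum is finite, so an infinite term is disposed of
   separately. *)
move=> F; have [[i ioo]|] := pselect (exists i, leb (F i) = +oo).
  rewrite (eseries_pinfty _ _ ioo) ?leey// => n _.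
  by rewrite -ltNye (lt_le_trans _ (leb_ge0 _)).
rewrite -forallNE => Foo.
apply/lee_addgt0Pr => _/posnumP[e].
rewrite (le_trans _ (epsilon_trick _ _ _))//; last by move=> n; exact: leb_ge0.
have /choice[C CP] : forall n, exists C, [/\ countable C,
    F n `<=` \bigcup_(p in C) box p &
    \esum_(p in C) (box_volume p)%:E <= leb (F n) + (e%:num / (2 ^ n.+1)%:R)%:E].
  move=> n; have en : (0 < e%:num / (2 ^ n.+1)%:R :> R)%R by [].
  have /(lb_ereal_inf_adherent en)[_ [C [cC FC] <-] /ltW Cle] :
      leb (F n) \is a fin_num by rewrite ge0_fin_numE ?leb_ge0// ltey; exact/eqP/Foo.
  by exists C.
(* The union is covered by all pairs [(n, p)] with [p] in the cover [C n], and the double sum is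
   then taken one [n] at a time. *)
apply: (@le_trans _ _ (\esum_(i in setT `*`` C) (box_volume i.2)%:E)).
  apply: leb_le_cover.
    apply: (@sub_countable _ _ _ (\bigcup_n [set (n, p) | p in C n])).
      by apply: subset_card_le => -[n p] [/= _ Cp]; exists n => //; exists p.
    apply: bigcup_countable => // n _.
    by have [cC _ _] := CP n; apply: sub_countable cC; exact: card_image_le.
  move=> x [n _ Fx]; have [_ /(_ _ Fx)[p Cp px] _] := CP n.
  by exists (n, p).
rewrite -(@esum_esum _ _ _ setT C (fun _ p => (box_volume p)%:E))//; last first.
  by move=> *; rewrite lee_fin box_volume_ge0.
rewrite -nneseries_esumT//; last first.
  by move=> n; apply: esum_ge0 => p _; rewrite lee_fin box_volume_ge0.
apply: lee_nneseries => [n _ _|n _]; last by have [] := CP n.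
by apply: esum_ge0 => p _; rewrite lee_fin box_volume_ge0.
Qed.

HB.instance Definition _ := isOuterMeasure.Build R 'rV[R]_d (@leb R d)
  (@leb_set0 R d) leb_ge0 le_leb leb_sigma_subadditive.

(** Being half-open, a box is cut by a hyperplane into two boxes of the same kind. When the
    hyperplane misses the box, one piece has crossed endpoints: it is empty and [box_volume] gives
    it 0. *)
Definition cut_le (i : 'I_d) (c : R) p : 'rV[R]_d * 'rV[R]_d :=
  (p.1, \row_j if j == i then Num.min (p.2 ord0 j) c else p.2 ord0 j)%R.

Definition cut_gt (i : 'I_d) (c : R) p : 'rV[R]_d * 'rV[R]_d :=
  (\row_j (if j == i then Num.max (p.1 ord0 j) c else p.1 ord0 j)%R, p.2).

(** All sides but the [i]-th are common factors; what is left is the splitting of the interval from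
    a to b at [c], checked on every relative order of the three numbers. *)
Lemma box_volume_cut i c p :
  box_volume p = (box_volume (cut_le i c p) + box_volume (cut_gt i c p))%R.
Proof.
have volE q : box_volume q = (Num.max 0 (q.2 ord0 i - q.1 ord0 i) *
    \prod_(j < d | j != i) Num.max 0 (q.2 ord0 j - q.1 ord0 j))%R.
  by rewrite /box_volume (bigD1 i).
rewrite !volE /= !mxE eqxx.
set q := (\prod_(j < d | j != i) _)%R.
have -> : (\prod_(j < d | j != i) Num.max 0 ((cut_le i c p).2 ord0 j - p.1 ord0 j))%R = q.
  by apply: eq_bigr => j /negbTE ji; rewrite mxE ji.
have -> : (\prod_(j < d | j != i) Num.max 0 (p.2 ord0 j - (cut_gt i c p).1 ord0 j))%R = q.
  by apply: eq_bigr => j /negbTE ji; rewrite mxE ji.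
rewrite -mulrDl; congr (_ * _)%R.
move: (p.2 ord0 i) (p.1 ord0 i) => b a.
rewrite !maxEle !minEle !subr_ge0.
have [bc|cb] := lerP b c; have [ac|ca] := lerP a c; have [ab|ba] := lerP a b.
all: do ?[case: ifPn => ?]; lra.
Qed.

(** Cutting each box of a cover of [X] yields covers of the two parts of [X] with the same total
    volume. The reverse inequality is subadditivity. *)
Lemma caratheodory_halfspace i c :
  (@leb R d).-caratheodory [set x | (x ord0 i <= c)%R].
Proof.
apply: le_caratheodory_measurable => X /=.
apply: le_ereal_inf_tmp => _ [C [cC XC] <-].
rewrite (eq_esum (fun p _ => congr1 EFin (box_volume_cut i c p))).
under eq_esum do rewrite EFinD.
rewrite esumD; do ?[by move=> p _; rewrite lee_fin box_volume_ge0].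
apply: leeD; apply: leb_le_cover => // x [/XC[p Cp px] /= xc]; exists p => // j.
  rewrite /= mxE; case: ifP => [/eqP->|_]; last exact: px.
  by rewrite le_min xc andbT; exact: px.
rewrite /= mxE; case: ifP => [/eqP->|_]; last exact: px.
by rewrite gt_max -andbA [(c < _)%R]ltNge (introN idP xc)/=; exact: px.
Qed.

Lemma caratheodory_box p : (@leb R d).-caratheodory (box p).
Proof.
have -> : box p = \big[setI/setT]_(i < d)
    (~` [set x | (x ord0 i <= p.1 ord0 i)%R] `&` [set x | (x ord0 i <= p.2 ord0 i)%R]).
  rewrite -bigcap_seq; apply/seteqP; split=> x /= px.
    by move=> i _; have /andP[p1 p2] := px i; split => //=; apply/negP; rewrite -ltNge.
  move=> i; have [/= /negP p1 p2] := px i (mem_index_enum _).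
  by rewrite ltNge p1.
elim/big_ind : _ => [|A B|i _].
- rewrite -setC0; apply: caratheodory_measurable_setC.
  exact: caratheodory_measurable_set0.
- exact: caratheodory_measurable_setI.
- apply: caratheodory_measurable_setI; last exact: caratheodory_halfspace.
  by apply: caratheodory_measurable_setC; exact: caratheodory_halfspace.
Qed.

(** [U] is the union of the boxes with rational corners that it contains. The value [None] absorbs
    the integers that encode no such box. *)
Lemma open_bigcup_box (U : set 'rV[R]_d) : open U ->
  exists e : nat -> option ('rV[R]_d * 'rV[R]_d),
    U = \bigcup_n (if e n is Some p then box p else set0).
Proof.
move=> oU.
pose rbox (q : 'rV[rat]_d * 'rV[rat]_d) : 'rV[R]_d * 'rV[R]_d :=
  (map_mx ratr q.1, map_mx ratr q.2).
exists (fun n => if (unpickle n : option ('rV[rat]_d * 'rV[rat]_d)) is Some q then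
  if `[<box (rbox q) `<=` U>] then Some (rbox q) else None else None).
apply/seteqP; split=> x.
  move=> Ux; have := oU; rewrite openE => /(_ _ Ux)/nbhs_ballP[e /= e0 eU].
  (* Balls of the sup norm are cubes, so corners within [e] of [x] in each coordinate keep the box
     inside the ball. The lower corner is strictly below [x] because boxes omit their left ends. *)
  have /choice[q1 q1P] : forall i, exists q : rat,
      ratr q \in `](x ord0 i - e)%R, x ord0 i[.
    by move=> i; apply: rat_in_itvoo; rewrite ltrBlDr ltrDl.
  have /choice[q2 q2P] : forall i, exists q : rat,
      ratr q \in `]x ord0 i, (x ord0 i + e)%R[.
    by move=> i; apply: rat_in_itvoo; rewrite ltrDl.
  pose q := (\row_i q1 i, \row_i q2 i) : 'rV[rat]_d * 'rV[rat]_d.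
  exists (pickle q) => //; rewrite pickleK.
  rewrite asboolT; last first.
    move=> y qy; apply: eU; split=> // i j; rewrite (ord1 i) /ball/=.
    have := qy j; have := q1P j; have := q2P j; rewrite !in_itv/= !mxE.
    by rewrite ltr_norml; lra.
  move=> i; have := q1P i; have := q2P i; rewrite !in_itv/= !mxE.
  by move=> /andP[/ltW ? _] /andP[_ ?]; apply/andP.
by move=> [n _]; case: unpickle => // q; case: asboolP => // + qx; apply.
Qed.

Lemma caratheodory_borel (B : set (borel 'rV[R]_d)) : measurable B ->
  (@leb R d).-caratheodory B.
Proof.
apply: smallest_sub.
  split; [exact: caratheodory_measurable_set0| |].
  - by move=> A mA; rewrite setTD; exact: caratheodory_measurable_setC.
  - by move=> F mF; exact: caratheodory_measurable_bigcup.
move=> U /open_bigcup_box[e ->]; apply: caratheodory_measurable_bigcup => n.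
case: (e n) => [p|]; first exact: caratheodory_box.
exact: caratheodory_measurable_set0.
Qed.

End lebesgue_outer_measure.

(** * The normalized Lebesgue measure as a probability on the domain *)

Section normalized_lebesgue.
Context (R : realType) (d : nat) (D : domain R d).
Implicit Type B : set (points D).

Lemma coords_inj : injective (@coords R d D).
Proof. exact: val_inj. Qed.

(** A Borel set of [points D] is the trace on [D] of a Borel set. As [D] is only Lebesgue
    measurable, its image need not be Borel, but it is a Carathéodory set. *)
Lemma caratheodory_coords B : measurable B ->
  (@leb R d).-caratheodory (@coords R d D @` B).
Proof.
move=> [C mC <-].
suff -> : @coords R d D @` (setT `&` @coords R d D @^-1` C) = C `&` D.
  apply: caratheodory_measurable_setI; first exact: caratheodory_borel.
  exact: domain_measurable.
apply/seteqP; split=> x.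
  by move=> [[y Dy] [_ /= Cy] <-]; split=> //; exact: set_mem.
move=> [Cx Dx]; exists (exist _ x (mem_set Dx)) => //.
Qed.

Let lebD_gt0 : (0 < fine (leb D))%R.
Proof. by rewrite fine_gt0// domain_gt0 domain_lty. Qed.

Let nu0 : @nu R d D set0 = 0.
Proof. by rewrite /nu image_set0 leb_set0 mul0e. Qed.

Let nu_ge0 B : 0 <= nu B.
Proof. by rewrite mule_ge0 ?leb_ge0// lee_fin invr_ge0 ltW. Qed.

Let nu_sigma_additive : semi_sigma_additive (@nu R d D).
Proof.
move=> F mF tF _.
have -> : (fun n => \sum_(0 <= i < n) nu (F i)) =
    (fun n => (fine (leb D))^-1%:E * \sum_(0 <= i < n) leb (@coords R d D @` F i)).
  apply/funext => n; rewrite ge0_sume_distrr//; last by move=> *; exact: leb_ge0.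
  by apply: eq_bigr => i _; rewrite muleC.
rewrite /nu image_bigcup muleC.
apply: cvgeZl => //.
apply: (@caratheodory_measure_sigma_additive _ _ (@leb R d)).
- by move=> i; exact: caratheodory_coords.
- move=> i j _ _ [x [[y Fy <-] [z Fz /coords_inj yz]]].
  by apply: (tF i j) => //; exists y; split=> //; rewrite -yz.
- by apply: caratheodory_measurable_bigcup => i; exact: caratheodory_coords.
Qed.

HB.instance Definition _ := isMeasure.Build _ (points D) R (@nu R d D)
  nu0 nu_ge0 nu_sigma_additive.

Lemma nu_setT : @nu R d D setT = 1.
Proof.
have -> : (@nu R d D setT = leb D * (fine (leb D))^-1%:E)%E.
  congr (leb _ * _); apply/seteqP; split=> x.
    by move=> [[y Dy] _ <-]; exact: set_mem.
  by move=> Dx; exists (exist _ x (mem_set Dx)).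
rewrite -[X in X * _]fineK; first by rewrite -EFinM divff// gt_eqF.
by rewrite ge0_fin_numE ?leb_ge0 ?domain_lty.
Qed.

HB.instance Definition _ :=
  Measure_isProbability.Build _ _ _ (@nu R d D) nu_setT.

End normalized_lebesgue.

(** * The score *)

Lemma measurable_coord (R : realType) m (i : 'I_m) :
  measurable_fun [set: borel 'rV[R]_m] (fun v : borel 'rV[R]_m => (v : 'rV[R]_m) ord0 i).
Proof.
apply: (measurability (@RGenOInfty.G R)); first exact: RGenOInfty.measurableE.
move=> _ [_ [r ->] <-]; rewrite setTI; apply: sub_sigma_algebra.
apply: open_comp => [v _|]; first exact: coord_continuous.
exact: interval_open.
Qed.

Lemma norm2_ge0 (R : realType) m (v : 'rV[R]_m) : (0 <= norm2 v)%R.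
Proof. exact: sqrtr_ge0. Qed.

Lemma norm2_eq0 (R : realType) m (v : 'rV[R]_m) : (norm2 v == 0%R) = (v == 0%R).
Proof.
apply/idP/eqP => [|->]; last first.
  by rewrite /norm2 big1 ?sqrtr0// => i _; rewrite mxE expr0n.
rewrite sqrtr_eq0 => v0; apply/rowP => i; apply/eqP; rewrite mxE -sqrf_eq0 eq_le.
rewrite sqr_ge0 andbT (le_trans _ v0)// (bigD1 i)//= lerDl sumr_ge0// => j _.
exact: sqr_ge0.
Qed.

Section band_score.
Context (R : realType) (d m : nat) (D : domain R d).
Context (dA : measure_display) (A : measurableType dA).
Variables (g gh : A * points D -> 'rV[R]_m) (eh : A * points D -> R) (gamma : R).
Hypothesis mg : measurable_fun setT (g : A * points D -> borel 'rV[R]_m).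
Hypothesis mgh : measurable_fun setT (gh : A * points D -> borel 'rV[R]_m).
Hypothesis meh : measurable_fun setT eh.
Hypothesis eh0 : forall p, (0 <= eh p)%R.
Hypothesis gamma_gt0 : (0 < gamma)%R.

(** The residual inequality with the division cleared, as one set of the product space, so that
    containment fractions are measures of its sections. *)
Let in_band (l : R) : set (A * points D) :=
  [set p | (norm2 (g p - gh p) <= l * eh p)%R].

Lemma measurable_in_band l : measurable (in_band l).
Proof.
have mcoord (f : A * points D -> 'rV[R]_m) i :
    measurable_fun setT (f : A * points D -> borel 'rV[R]_m) ->
    measurable_fun setT (fun p => f p ord0 i).
  by move=> mf; exact: (measurableT_comp (measurable_coord i) mf).
have msum : measurable_fun setT (fun p => \sum_(i < m) (g p - gh p) ord0 i ^+ 2)%R.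
  apply: measurable_sum => i; apply: measurable_funX.
  by under eq_fun do rewrite !mxE; apply: measurable_funB; exact: mcoord.
have msqrt : measurable_fun setT (@Num.sqrt R).
  by apply: continuous_measurable_fun; exact: sqrt_continuous.
rewrite -[X in measurable X]setTI; apply: measurable_fun_le => //.
  exact: (measurableT_comp msqrt msum).
by apply: measurable_funM.
Qed.

(** Where [eh] vanishes the band has radius 0 for every finite [l]; the values 0 and [+oo] given to
    the residual there say precisely whether the prediction is exact. *)
Lemma residual_le a x l : (0 <= l)%R ->
  (residual g gh eh a x <= l%:E) = (norm2 (g (a, x) - gh (a, x)) <= l * eh (a, x))%R.
Proof.
move=> l0; rewrite /residual; have [e0|e0] := eqVneq (eh (a, x)) 0%R.
  rewrite e0 mulr0 [RHS]le_eqVlt [(_ < 0)%R]ltNge norm2_ge0 orbF norm2_eq0 subr_eq0.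
  by case: ifPn => _; rewrite ?leye_eq// lee_fin.
by rewrite lee_fin ler_pdivrMr// lt_neqAle eq_sym e0 eh0.
Qed.

Lemma containment_xsection a l : (0 <= l)%R ->
  containment g gh eh l%:E a = nu (xsection (in_band l) a).
Proof.
move=> l0; congr nu; apply/seteqP; split=> x;
  by rewrite /xsection/= inE/= residual_le.
Qed.

Lemma containment_pinfty a : containment g gh eh +oo a = 1.
Proof.
rewrite -(nu_setT D); congr nu; apply/seteqP; split=> x //= _; exact: leey.
Qed.

Lemma coverage_containment a (lambda : \bar R) : 0 <= lambda ->
  coverage g gh eh lambda a = containment g gh eh lambda a.
Proof.
case: lambda => [l|_|//].
  rewrite lee_fin => l0; congr nu; apply/seteqP; split=> x;
  by rewrite /= residual_le.
by rewrite containment_pinfty -(nu_setT D).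
Qed.

Lemma score_ge0 a : 0 <= score g gh eh gamma a.
Proof. by apply: le_ereal_inf_tmp => _ [l [l0 _] <-]; rewrite lee_fin. Qed.

Lemma measurable_containment l : (0 <= l)%R ->
  measurable_fun setT (containment g gh eh l%:E).
Proof.
move=> l0; rewrite (_ : containment _ _ _ _ = @nu R d D \o xsection (in_band l)).
  apply: (@measurable_fun_xsection _ _ _ _ _ (@nu R d D)).
  exact: measurable_in_band.
by apply/funext => a; rewrite containment_xsection.
Qed.

(* By right continuity of the containment fraction. *)
Lemma score_le a (lambda : \bar R) : 0 <= lambda ->
  (score g gh eh gamma a <= lambda) = ((1 - gamma)%:E <= containment g gh eh lambda a).
Proof.
case: lambda => [l|_|//]; last first.
  by rewrite leey containment_pinfty lee_fin lerBlDr lerDl ltW.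
rewrite lee_fin => l0; apply/idP/idP => [sl|wl]; last first.
  by apply: ereal_inf_lbound; exists l.
pose B n : set (points D) := xsection (in_band (l + n.+1%:R^-1)%R) a.
have ln0 n : (0 <= l + n.+1%:R^-1)%R by rewrite addr_ge0.
have mB n : measurable (B n).
  by apply: measurable_xsection; exact: measurable_in_band.
have niB : nonincreasing_seq B.
  move=> i j ij; apply/subsetPset => x; rewrite /B/= /xsection/= !inE /in_band/=.
  move=> /le_trans; apply; rewrite ler_wpM2r// lerD2l lef_pV2 ?posrE//.
  by rewrite ler_nat.
have BE : \bigcap_n B n = xsection (in_band l) a.
  apply/seteqP; split=> x; rewrite /xsection/= inE/=.
    move=> Bx; apply/ler_addgt0Pr => e e0.
    (* The excess width is [eh (a, x)] divided by n+1. Comparing with [e / (eh (a, x) + 1)] keeps it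
       below [e] without dividing by a possibly zero [eh (a, x)]. *)
    have [n _ /(_ n (leqnn n)) ne] := near_infty_natSinv_lt (PosNum (divr_gt0 e0
      (ltr_wpDl (eh0 (a, x)) ltr01))).
    have := Bx n I; rewrite /B/= /xsection/= inE /in_band/= => /le_trans; apply.
    rewrite mulrDl lerD2l (le_trans (ler_wpM2r _ (ltW ne)))//= mulrAC.
    by rewrite ler_pdivrMr ?ltr_wpDl// mulrDr mulr1 lerDl ltW.
  move=> Bx n _; rewrite /B/= /xsection/= inE /in_band/=.
  by apply: (le_trans Bx); rewrite ler_wpM2r// lerDl.
rewrite containment_xsection// -BE.
have /cvg_lim <- // : @nu R d D \o B @ \oo --> nu (\bigcap_n B n).
  apply: nonincreasing_cvg_mu => //.
    by rewrite (le_lt_trans (probability_le1 _ (mB 0%N)))// ltry.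
  by apply: bigcap_measurable => //; exists 0%N.
apply: lime_ge.
  apply: ereal_nonincreasing_is_cvgn => i j ij /=.
  by apply: le_measure; rewrite ?inE//; exact/subsetPset/niB.
apply: nearW => n /=.
(* The infimum is below [l + n.+1%:R^-1], so an admissible [r] is too; the band of [r] lies inside
   the [n]-th band. *)
have /ereal_inf_lt[_ [r [r0 wr] <-] rl] : score g gh eh gamma a < (l + n.+1%:R^-1)%:E.
  by rewrite (le_lt_trans sl)// lte_fin ltrDl.
apply: (le_trans wr); rewrite containment_xsection//; apply: le_measure.
- by rewrite inE; apply: measurable_xsection; exact: measurable_in_band.
- by rewrite inE.
- move=> x; rewrite /B/= /xsection/= !inE /in_band/= => /le_trans; apply.
  by rewrite ler_wpM2r// ltW// -lte_fin.
Qed.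

Lemma measurable_score : measurable_fun setT (score g gh eh gamma).
Proof.
apply: (measurability (@ErealGenOInfty.G R)); first exact: ErealGenOInfty.measurableE.
move=> _ [_ [r ->] <-]; rewrite setTI.
have [r0|r0] := leP 0%R r; last first.
  rewrite (_ : _ @^-1` _ = setT)//; apply/seteqP; split=> // a _ /=.
  by rewrite in_itv/= andbT (lt_le_trans _ (score_ge0 a))// lte_fin.
rewrite (_ : _ @^-1` _ = ~` (setT `&` [set a | (1 - gamma)%:E <= containment g gh eh r%:E a])).
  by apply: measurableC; apply: emeasurable_fun_c_infty => //; exact: measurable_containment.
apply/seteqP; split=> a /=; rewrite in_itv/= andbT.
  by rewrite ltNge score_le ?lee_fin// => /negP wa [_].
by move=> wa; rewrite ltNge score_le ?lee_fin//; apply/negP => ?; exact: wa.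
Qed.

End band_score.

(** * Order statistics and exchangeability *)

Section order_statistics.
Context (disp : Order.disp_t) (T : orderType disp).
Implicit Types (x : T) (s : seq T).
Local Open Scope order_scope.
Local Open Scope set_scope.

(** In the sorted list the entries below [x] form the initial segment of length [count (< x) s], and
    index [i], counted from 0, lies beyond it iff that length is at most [i]. *)
Lemma le_nth_sort x0 x s i : (i < size s)%N ->
  (x <= nth x0 (sort <=%O s) i) = (count (< x) s <= i)%N.
Proof.
move=> si; have ss : sorted <=%O (sort <=%O s) by exact/sort_sorted/le_total.
have <- : count (< x) (sort <=%O s) = count (< x) s by apply/seq.permP; rewrite perm_sort.
apply/idP/idP => [xs|xs]; last by apply: nth_count_ge => //; rewrite xs size_sort.
by rewrite leqNgt; apply: contraTN xs => /(nth_count_lt x0 ss); rewrite ltNge.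
Qed.

Lemma nth_sort_le x0 x s i : (i < size s)%N ->
  (nth x0 (sort <=%O s) i <= x) = (i < count (<= x) s)%N.
Proof.
move=> si; have ss : sorted <=%O (sort <=%O s) by exact/sort_sorted/le_total.
have <- : count (<= x) (sort <=%O s) = count (<= x) s by apply/seq.permP; rewrite perm_sort.
apply/idP/idP => [xs|]; last exact: nth_count_le.
rewrite ltnNge; apply: contraTN xs => xs; rewrite -ltNge.
by apply: nth_count_gt => //; rewrite xs size_sort.
Qed.

Lemma card_low_rank (I : finType) (f : I -> T) k : (k <= #|I|)%N ->
  (k <= #|[set j | #|[set i | (f i < f j)%O]| < k]|)%N.
Proof.
move=> kI; set E := [set j | _].
have [/eqP CE|/set0Pn[j0 j0E]] := boolP (~: E == finset.set0).
  by rewrite -[E]finset.setCK CE finset.setC0 cardsT.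
(* For [j] minimizing [f] outside [E], everything strictly below [f j] is in [E]; since [j] is not
   in [E], there are at least [k] such indices. *)
have [j jE jmin] := arg_minP f j0E.
have : j \in ~: E := jE; rewrite finset.in_setC finset.in_set -leqNgt => /leq_trans; apply.
apply/subset_leq_card/fintype.subsetP => i; rewrite inE => ij.
by apply: contraTT ij => iE; rewrite -leNgt; apply: jmin; rewrite -finset.in_setC in iE.
Qed.

Lemma card_strictly_low_rank (I : finType) (f : I -> T) k :
  (#|[set j | #|[set i | (f i <= f j)%O]| <= k]| <= k)%N.
Proof.
set E := [set j | _].
have [/eqP->|/set0Pn[j0 j0E]] := boolP (E == finset.set0); first by rewrite cards0.
(* For [j] maximizing [f] on [E], all of [E] is among the indices with value at most [f j], and
   there are at most [k] of these. *)
have [j jE jmax] := arg_maxP f j0E.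
have : j \in E := jE; rewrite finset.in_set; apply: leq_trans.
by apply/subset_leq_card/fintype.subsetP => i iE; rewrite finset.in_set; exact: jmax.
Qed.

End order_statistics.

Section threshold_rank.
Context (R : realType) (n k : nat) (s : 'I_n.+1 -> \bar R).
Hypothesis k_gt0 : (0 < k)%N.
Local Open Scope set_scope.

Lemma threshold_le (t : \bar R) : (k <= n)%N ->
  (threshold k s <= t) = (k <= #|[set i : 'I_n | (s (widen_ord (leqnSn n) i) <= t)%E]|)%N.
Proof.
move=> kn; rewrite /threshold kn /kth_smallest nth_sort_le; last first.
  by rewrite size_map size_enum_ord prednK.
rewrite prednK// count_map cardE [in RHS]/enum_mem size_filter -enumT.
congr (_ <= _)%N. by apply: eq_count => i; exact: esym (finset.in_set _ _).
Qed.

(** The last score is not strictly below itself, so the count over the first [n] indices can be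
    taken over all [n.+1], the form on which permutations act. *)
Lemma le_threshold : (k <= n.+1)%N ->
  (s ord_max <= threshold k s) = (#|[set i | (s i < s ord_max)%E]| < k)%N.
Proof.
move=> kn1.
have rankE : #|[set i | s i < s ord_max]| =
    count (fun i : 'I_n => s (widen_ord (leqnSn n) i) < s ord_max) (enum 'I_n).
  rewrite -sum1_card big_mkcond big_ord_recr/= inE ltxx addn0.
  rewrite -sum1_count big_enum_cond/= [RHS]big_mkcond.
  by apply: eq_bigr => i _; rewrite inE.
(* For k = n+1 the threshold is [+oo], and at most [n] scores lie strictly below the last one, so
   both sides hold. *)
rewrite /threshold; case: ifPn => [kn|]; last first.
  rewrite -ltnNge => nk; rewrite leey rankE.
  by rewrite (leq_ltn_trans (count_size _ _))// size_enum_ord.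
rewrite /kth_smallest le_nth_sort; last by rewrite size_map size_enum_ord prednK.
by rewrite count_map rankE -ltnS prednK.
Qed.

Lemma threshold_ge0 : (forall i, (0 <= s i)%E) -> (0 <= threshold k s)%E.
Proof.
move=> s0; rewrite /threshold; case: ifPn => // kn.
rewrite /kth_smallest le_nth_sort; last by rewrite size_map size_enum_ord prednK.
rewrite count_map (@eq_count _ _ pred0) ?count_pred0// => i /=.
by apply/negbTE; rewrite -leNgt.
Qed.

End threshold_rank.

Section exchangeable_rank.
Context (dO : measure_display) (Omega : measurableType dO) (R : realType).
Variable P : probability Omega R.
Context (dT : measure_display) (T : measurableType dT) (n : nat).
Variables (X : 'I_n.+1 -> Omega -> T) (s : T -> \bar R).
Hypothesis mX : forall i, measurable_fun setT (X i).
Hypothesis ms : measurable_fun setT s.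

Section rank.
Variable r : rel (\bar R).
Hypothesis mr : forall d' (T' : measurableType d') (f g : T' -> \bar R),
  measurable_fun setT f -> measurable_fun setT g -> measurable [set x | r (f x) (g x)].

(** The event splits according to the exact set [J] of indices in relation [r]. The space [T'] is
    left free since this serves on tuples, on [Omega] and on [Omega] with a coarser
    sigma-algebra. *)
Lemma measurable_rank d' (T' : measurableType d') (I : finType)
    (f : I -> T' -> \bar R) (g : T' -> \bar R) k :
  (forall i, measurable_fun setT (f i)) -> measurable_fun setT g ->
  measurable [set x | (#|[set i | r (f i x) (g x)]%SET| < k)%N].
Proof.
move=> mf mg.
rewrite (_ : [set x | _] = \big[setU/set0]_(J : {set I} | (#|J| < k)%N)
    \big[setI/setT]_i (if i \in J then [set x | r (f i x) (g x)]
                       else ~` [set x | r (f i x) (g x)])); last first.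
  rewrite -bigcup_seq_cond; apply/seteqP; split=> x /=.
    move=> xk; exists [set i | r (f i x) (g x)]%SET; first by rewrite /= mem_index_enum.
    by rewrite -bigcap_seq => i _; rewrite inE; case: ifPn => //= /negP.
  move=> [J /= /andP[_ Jk]]; rewrite -bigcap_seq => xJ.
  rewrite (_ : [set i | r (f i x) (g x)]%SET = J)//; apply/setP => i; rewrite inE.
  by have := xJ i (mem_index_enum _); case: ifPn => [_|_ /negP/negbTE].
apply: bigsetU_measurable => J _; apply: bigsetI_measurable => i _.
by case: ifPn => _; [|apply: measurableC]; exact: mr.
Qed.

Lemma exchangeable_rank k (j : 'I_n.+1) : exchangeable P X ->
  P [set w | (#|[set i | r (s (X i w)) (s (X j w))]%SET| < k)%N] =
  P [set w | (#|[set i | r (s (X i w)) (s (X ord_max w))]%SET| < k)%N].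
Proof.
pose B := [set t : n.+1.-tuple T |
  (#|[set i | r (s (tnth t i)) (s (tnth t ord_max))]%SET| < k)%N].
have mB : measurable B.
  by apply: (measurable_rank k) => [i|]; exact: (measurableT_comp ms (measurable_tnth _)).
(* Swapping [j'] with the last index turns the rank of [j'] into the rank of the last entry, as the
   count over all indices is invariant under reindexing. *)
pose t j' w := [tuple X (tperm j' ord_max i) w | i < n.+1].
have rankE j' w : #|[set i | r (s (tnth (t j' w) i)) (s (tnth (t j' w) ord_max))]%SET| =
    #|[set i | r (s (X i w)) (s (X j' w))]%SET|.
  rewrite -!sum1_card [RHS](reindex_inj (@perm_inj _ (tperm j' ord_max)))/=.
  by apply: eq_bigl => i; rewrite !finset.in_set !tnth_mktuple tpermR.
have PE j' : P [set w | (#|[set i | r (s (X i w)) (s (X j' w))]%SET| < k)%N] =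
    P [set w | B (t j' w)].
  by congr (P _); apply/seteqP; split=> w; rewrite /B/= rankE.
move=> exX; rewrite !PE; transitivity (P [set w | B [tuple X i w | i < n.+1]]).
  exact: exX.
exact/esym/exX.
Qed.

End rank.
Let measurable_rank_event (r : rel (\bar R)) k j :
  (forall d' (T' : measurableType d') (f g : T' -> \bar R),
    measurable_fun setT f -> measurable_fun setT g -> measurable [set x | r (f x) (g x)]) ->
  measurable [set w | (#|[set i | r (s (X i w)) (s (X j w))]%SET| < k)%N].
Proof.
move=> mr; apply: (measurable_rank mr (f := fun i w => s (X i w))) => [i|];
  exact: (measurableT_comp ms (mX _)).
Qed.

Lemma measurable_ltE d' (T' : measurableType d') (f g : T' -> \bar R) :
  measurable_fun setT f -> measurable_fun setT g -> measurable [set x | f x < g x].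
Proof.
by move=> mf mg; rewrite -[X in measurable X]setTI; exact: measurable_lte.
Qed.

Lemma measurable_leE d' (T' : measurableType d') (f g : T' -> \bar R) :
  measurable_fun setT f -> measurable_fun setT g -> measurable [set x | f x <= g x].
Proof.
by move=> mf mg; rewrite -[X in measurable X]setTI; exact: measurable_lee.
Qed.

Lemma measurable_rank_lt k j :
  measurable [set w | (#|[set i | (s (X i w) < s (X j w))%E]%SET| < k)%N].
Proof. exact: (measurable_rank_event _ _ measurable_ltE). Qed.

Lemma measurable_rank_le k j :
  measurable [set w | (#|[set i | (s (X i w) <= s (X j w))%E]%SET| < k)%N].
Proof. exact: (measurable_rank_event _ _ measurable_leE). Qed.

Let sum_indic (I : finType) (E : I -> set Omega) w :
  \sum_i (\1_(E i) w)%:E = #|[set i | w \in E i]%SET|%:R%:E :> \bar R.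
Proof.
rewrite sumEFin; congr EFin; under eq_bigr do rewrite indicE.
rewrite -natr_sum -sum1_card [in RHS]big_mkcond; congr (_%:R)%R.
by apply: eq_bigr => i _; rewrite finset.in_set; case: (w \in E i).
Qed.

Let sum_probability (I : finType) (E : I -> set Omega) :
  (forall i, measurable (E i)) ->
  \sum_i P (E i) = \int[P]_w (\sum_i (\1_(E i) w)%:E).
Proof.
move=> mE; rewrite ge0_integral_sum//; last first.
  by move=> i; apply/measurable_EFinP; exact: measurable_indic.
by apply: eq_bigr => i _; rewrite integral_indic// setIT.
Qed.

Let sum_const (p : \bar R) : \sum_(j < n.+1) p = n.+1%:R%:E * p.
Proof. by rewrite sumr_const card_ord mule_natl. Qed.

Let measurable_sum_indic (I : finType) (E : I -> set Omega) :
  (forall i, measurable (E i)) ->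
  measurable_fun setT (fun w => \sum_i (\1_(E i) w)%:E : \bar R).
Proof.
move=> mE; apply: emeasurable_sum => i; apply/measurable_EFinP.
exact: measurable_indic.
Qed.

Lemma exchangeable_rank_lt k : (k <= n.+1)%N -> exchangeable P X ->
  (k%:R / n.+1%:R)%:E <=
  P [set w | (#|[set i | (s (X i w) < s (X ord_max w))%E]%SET| < k)%N].
Proof.
move=> kn exX.
pose E j := [set w | (#|[set i | (s (X i w) < s (X j w))%E]%SET| < k)%N].
have mE j : measurable (E j) by exact: measurable_rank_lt.
(* The sum is the expected number of indices of low rank, and this number is at least [k] at every
   outcome. *)
have : k%:R%:E <= \sum_j P (E j).
  rewrite sum_probability//.
  have -> : k%:R%:E = \int[P]_w (k%:R%:E : \bar R).
    by rewrite integral_cst//= probability_setT mule1.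
  apply: ge0_le_integral => //.
  - exact: measurable_sum_indic.
  - move=> w _; rewrite sum_indic lee_fin ler_nat.
    have := card_low_rank (fun i => s (X i w)) (k := k); rewrite card_ord => /(_ kn).
    move=> /leq_trans; apply; apply/subset_leq_card/fintype.subsetP => i.
    by rewrite !finset.in_set inE.
rewrite (eq_bigr (fun=> P (E ord_max))); last first.
  by move=> j _; exact: exchangeable_rank measurable_ltE _ _ exX.
by rewrite sum_const mulrC EFinM lee_pdivrMl.
Qed.

(** The weak rank counts the index itself, hence [<= k] here where the strict rank has [< k]. *)
Lemma exchangeable_rank_le k : exchangeable P X ->
  P [set w | (#|[set i | (s (X i w) <= s (X ord_max w))%E]%SET| <= k)%N] <=
  (k%:R / n.+1%:R)%:E.
Proof.
move=> exX.
pose E j := [set w | (#|[set i | (s (X i w) <= s (X j w))%E]%SET| < k.+1)%N].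
have mE j : measurable (E j) by exact: measurable_rank_le.
have : \sum_j P (E j) <= k%:R%:E.
  rewrite sum_probability//.
  have -> : k%:R%:E = \int[P]_w (k%:R%:E : \bar R).
    by rewrite integral_cst//= probability_setT mule1.
  apply: ge0_le_integral => //.
  - by move=> w _; rewrite sum_indic lee_fin.
  - exact: measurable_sum_indic.
  - move=> w _; rewrite sum_indic lee_fin ler_nat.
    apply: leq_trans (card_strictly_low_rank (fun i => s (X i w)) k).
    apply/subset_leq_card/fintype.subsetP => i.
    by rewrite !finset.in_set inE.
rewrite (eq_bigr (fun=> P (E ord_max))); last first.
  by move=> j _; exact: exchangeable_rank measurable_leE _ _ exX.
by rewrite sum_const mulrC EFinM lee_pdivlMl.
Qed.

End exchangeable_rank.

(** * Conditioning on a sub-sigma-algebra *)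

Section sub_sigma_algebra.
Context (dO : measure_display) (Omega : measurableType dO) (R : realType).
Variables (P : probability Omega R) (C : set (set Omega)).
Hypothesis Cm : C `<=` measurable.

Let sub_measurable F : <<s C >> F -> measurable F.
Proof. by apply: smallest_sub => //; exact: sigma_algebra_measurable. Qed.

(* The identity of Omega, as a measurable map onto the coarser space. *)
Definition coarsen : Omega -> g_sigma_algebraType C := fun w => w.

Lemma measurable_coarsen : measurable_fun setT coarsen.
Proof. by move=> _ F mF; rewrite setTI; exact: sub_measurable. Qed.

Let mcoarsen : {mfun Omega >-> g_sigma_algebraType C} :=
  HB.pack coarsen (isMeasurableFun.Build _ _ _ _ coarsen measurable_coarsen).

(** Under the pushforward of [P] along [coarsen], the test sets of [integral_ae_eq] are exactly
    those of the definition of conditional probability. *)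
Lemma is_cond_prob_ae_unique (E : set Omega) (Z1 Z2 : Omega -> R) :
  is_cond_prob P E <<s C >> Z1 -> is_cond_prob P E <<s C >> Z2 ->
  exists N : set Omega, [/\ measurable N, P N = 0 & forall w, ~ N w -> Z1 w = Z2 w].
Proof.
move=> [mZ1 iZ1 Z1E] [mZ2 iZ2 Z2E].
have mZ (Z : Omega -> R) : (forall B, measurable B -> <<s C >> (Z @^-1` B)) ->
    measurable_fun setT (EFin \o Z : g_sigma_algebraType C -> \bar R).
  by move=> mZ; apply/measurable_EFinP => _ B mB; rewrite setTI; exact: mZ.
have /integral_ae_eq : (distribution P mcoarsen).-integrable setT
    (EFin \o Z1 : g_sigma_algebraType C -> \bar R).
  by apply: integrable_pushforward => //; do ?[exact: measurable_coarsen|exact: mZ].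
move=> /(_ measurableT (EFin \o Z2) (mZ _ mZ2)) [].
  move=> F _ mF; rewrite /distribution !integral_pushforward//;
    do ?[exact: mZ | exact: measurable_coarsen].
  - by rewrite [LHS]Z1E// [RHS]Z2E.
  - by apply: (integrableS measurableT) => //; exact: sub_measurable.
  - by apply: (integrableS measurableT) => //; exact: sub_measurable.
move=> N [mN PN NP]; exists N; split=> //; first exact: sub_measurable.
move=> w /contra_notP; apply => Zw; apply: NP => /(_ I)[]; exact: Zw.
Qed.

Lemma is_cond_prob_law_unique (E : set Omega) (Z1 Z2 : Omega -> R) (B : set R) :
  is_cond_prob P E <<s C >> Z1 -> is_cond_prob P E <<s C >> Z2 -> measurable B ->
  P (Z1 @^-1` B) = P (Z2 @^-1` B).
Proof.
suff le (Z Z' : Omega -> R) : is_cond_prob P E <<s C >> Z ->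
    is_cond_prob P E <<s C >> Z' -> measurable B -> P (Z @^-1` B) <= P (Z' @^-1` B).
  by move=> c1 c2 mB; apply/eqP; rewrite eq_le !le.
move=> c c' mB; have [N [mN PN ZZ']] := is_cond_prob_ae_unique c c'.
have [[mZ _ _] [mZ' _ _]] := (c, c').
have mZB := sub_measurable (mZ _ mB); have mZ'B := sub_measurable (mZ' _ mB).
apply: (@le_trans _ _ (P (Z' @^-1` B `|` N))).
  apply: le_measure; rewrite ?inE//; first exact: measurableU.
  move=> w /= ZB; have [Nw|nNw] := pselect (N w); first by right.
  by left; rewrite /= -ZZ'.
by rewrite (le_trans (measureU2 _ _ _))// -[X in _ <= X]adde0 -PN.
Qed.

Section independent.
Context (dT : measure_display) (V : measurableType dT).
Variable (S : Omega -> V).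
Hypothesis mS : measurable_fun setT S.
Hypothesis indep : forall F B, <<s C >> F -> measurable B ->
  P (F `&` S @^-1` B) = P F * P (S @^-1` B).

Let mfS : {mfun Omega >-> V} := HB.pack S (isMeasurableFun.Build _ _ _ _ S mS).

Let mpair : measurable_fun setT (fun w => (coarsen w, S w)).
Proof. by apply/measurable_fun_pair => //; exact: measurable_coarsen. Qed.

Let mfpair : {mfun Omega >-> (g_sigma_algebraType C * V)%type} :=
  HB.pack (fun w => (coarsen w, S w)) (isMeasurableFun.Build _ _ _ _ _ mpair).

Lemma measurable_independent_section (Q : set (g_sigma_algebraType C * V)) :
  measurable Q ->
  measurable_fun setT (fun w : g_sigma_algebraType C => P [set w' | Q (w, S w')]).
Proof.
move=> mQ; rewrite (_ : (fun _ => _) = distribution P mfS \o xsection Q).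
  exact: measurable_fun_xsection.
apply/funext => w /=; congr (P _).
by apply/seteqP; split=> w' /=; rewrite /xsection/= inE.
Qed.

(** Freezing lemma: given [<<s C >>], the first argument of [Q] may be held fixed. By independence
    the joint law of [coarsen] and [S] agrees with the product law on rectangles, hence everywhere,
    and the product measure integrates sections. *)
Lemma independent_section (Q : set (g_sigma_algebraType C * V)) F :
  measurable Q -> <<s C >> F ->
  P (F `&` [set w | Q (coarsen w, S w)]) =
  \int[P]_(w in F) P [set w' | Q (coarsen w, S w')].
Proof.
move=> mQ mF.
(* Absorbing [F] into the set turns the claim into the product formula for a single set; its
   sections over points outside [F] are empty. *)
pose Q' := Q `&` (F `*` setT).
have mQ' : measurable Q' by apply: measurableI => //; exact: measurableX.
have mE A B : measurable A -> measurable B ->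
    distribution P mfpair (A `*` B) = distribution P mcoarsen A * distribution P mfS B.
  exact: indep.
have := @product_measure_unique _ _ _ _ R (distribution P mcoarsen) (distribution P mfS)
  (distribution P mfpair) mE _ mQ'.
move=> H; transitivity (distribution P mfpair Q').
  congr (P _); apply/seteqP; split=> w; first by case=> ? ?; split.
  by case=> ? [].
rewrite -H /product_measure1 ge0_integral_pushforward//;
  do ?[exact: measurable_coarsen | exact: measurable_fun_xsection].
rewrite [RHS]integral_mkcond preimage_setT.
apply: eq_integral => w _; rewrite patchE /=.
have [wF|wF] := boolP (w \in F).
  congr (P _); apply/seteqP; split=> w' /=; rewrite /xsection/= inE/=; first by case.
  by move=> Qw; split=> //; split=> //=; exact: set_mem.
rewrite [X in distribution P mfS X](_ : _ = set0) ?measure0//.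
rewrite -subset0 => v; rewrite /xsection/= inE => -[_ [/= Fw _]].
by move: wF; rewrite notin_setE; exact.
Qed.

End independent.
End sub_sigma_algebra.

(** * Independence of the last variable from the preceding ones jointly *)

Section independent_prefix.
Context (dO : measure_display) (Omega : measurableType dO) (R : realType).
Variable P : probability Omega R.
Context (dT : measure_display) (T : measurableType dT) (n : nat).
Variable X : 'I_n.+1 -> Omega -> T.
Hypothesis mX : forall i, measurable_fun setT (X i).

Let prefix : set (set Omega) := \big[setU/set0]_(i < n)
  preimage_set_system setT (X (widen_ord (leqnSn n) i)) measurable.

Lemma prefix_measurable : prefix `<=` measurable.
Proof.
move=> F; rewrite /prefix -bigcup_seq => -[i _ [B mB <-]]; exact: mX.
Qed.

Lemma prefix_preimage (i : 'I_n) B : measurable B ->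
  prefix (X (widen_ord (leqnSn n) i) @^-1` B).
Proof.
move=> mB; rewrite /prefix -bigcup_seq; exists i; first by rewrite /= mem_index_enum.
by exists B => //; rewrite setTI.
Qed.

Hypothesis indep : mutually_independent P X.

Lemma independent_rectangle (B : 'I_n -> set T) (B' : set T) :
  (forall i, measurable (B i)) -> measurable B' ->
  P ((\bigcap_i X (widen_ord (leqnSn n) i) @^-1` B i) `&` X ord_max @^-1` B') =
  (\big[*%E/1]_i P (X (widen_ord (leqnSn n) i) @^-1` B i)) * P (X ord_max @^-1` B').
Proof.
move=> mB mB'.
(* Glues [B] and [B'] into a family over all indices; [unlift ord_max] is [None] only at the last
   one. *)
pose BB (j : 'I_n.+1) := if unlift ord_max j is Some i then B i else B'.
have widenE i : widen_ord (leqnSn n) i = lift ord_max i.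
  by apply/val_inj; exact: esym (lift_max i).
have BBw i : BB (widen_ord (leqnSn n) i) = B i.
  by rewrite /BB widenE liftK.
have BBm : BB ord_max = B' by rewrite /BB unlift_none.
have mBB j : measurable (BB j) by rewrite /BB; case: unlift.
have := indep [set: 'I_n.+1]%SET mBB.
rewrite (eq_bigl xpredT); last by move=> j; rewrite finset.in_setT.
rewrite big_ord_recr/= BBm.
under eq_bigr do rewrite BBw.
move=> <-; congr (P _); apply/seteqP; split=> w.
  move=> [wB wB'] j _; have [i ->|->] := unliftP ord_max j.
    by rewrite /BB liftK -widenE; exact: wB.
  by rewrite BBm.
move=> wBB; split; last by have := wBB ord_max (finset.in_setT _); rewrite BBm.
by move=> i _; rewrite -BBw; apply: wBB; rewrite /= finset.in_setT.
Qed.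

(** Both sides are finite measures in [F]. The generators [prefix] are not stable under
    intersection, so the measures are compared on the cylinders [G], which are, and which contain
    [prefix] and [setT]. *)
Lemma independent_prefix F (B : set T) : <<s prefix >> F -> measurable B ->
  P (F `&` X ord_max @^-1` B) = P F * P (X ord_max @^-1` B).
Proof.
move=> mF mB.
have mXB : measurable (X ord_max @^-1` B) by rewrite -[X in measurable X]setTI; exact: mX.
pose G := [set F | exists2 A : 'I_n -> set T, (forall i, measurable (A i)) &
  F = \bigcap_i X (widen_ord (leqnSn n) i) @^-1` A i].
have GT : G setT.
  by exists (fun=> setT) => //; apply/seteqP; split.
have Gm : G `<=` measurable.
  move=> _ [A mA ->]; apply: fin_bigcap_measurable => // i _.
  by rewrite -[X in measurable X]setTI; exact: mX.
have GI : setI_closed G.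
  move=> _ _ [A mA ->] [A' mA' ->]; exists (fun i => A i `&` A' i).
    by move=> i; exact: measurableI.
  by rewrite -bigcapI; apply: eq_bigcapr => i _; rewrite preimage_setI.
have prefixG : prefix `<=` G.
  move=> E; rewrite /prefix -bigcup_seq => -[i _ [A mA <-]].
  exists (fun j => if j == i then A else setT); first by move=> j; case: ifP.
  rewrite setTI; apply/seteqP; split=> w.
    by move=> Aw j _; rewrite /preimage/=; case: ifPn => // /eqP ->.
  by move=> /(_ i I); rewrite /preimage/= eqxx.
have PB0 : (0 <= fine (P (X ord_max @^-1` B)))%R by rewrite fine_ge0.
have PBE : (fine (P (X ord_max @^-1` B)))%:E = P (X ord_max @^-1` B).
  by rewrite fineK// fin_num_measure.
rewrite muleC -PBE.
apply: (@g_sigma_algebra_measure_unique _ R Omega G Gm (fun=> setT) (fun=> GT) _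
  (mrestr P mXB) (mscale (NngNum PB0) P) GI).
- by rewrite bigcup_const.
- move=> _ [A mA ->].
  set A' := \bigcap_i _.
  transitivity (P A' * P (X ord_max @^-1` B)); last first.
    by rewrite /mscale muleC; congr (_ * _); exact: esym PBE.
  transitivity ((\big[*%E/1]_i P (X (widen_ord (leqnSn n) i) @^-1` A i)) *
    P (X ord_max @^-1` B)); first exact: independent_rectangle.
  have := independent_rectangle mA measurableT.
  by rewrite preimage_setT setIT probability_setT mule1 => <-.
- move=> _; apply: (@le_lt_trans _ _ 1); last exact: ltry.
  by apply: probability_le1; exact: measurableI.
- by move: F mF; apply: sub_sigma_algebra2.
Qed.

End independent_prefix.

(** * The Beta distribution function *)

Section beta_distribution_function.
Local Open Scope ring_scope.
Context (R : realType).
Implicit Types (n k : nat) (t : R).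

(** The probability of at least [k] successes in [n] independent trials, as a polynomial in the
    success probability so that it can be differentiated formally. *)
Definition binomial_tail n k : {poly R} :=
  \sum_(j < n.+1 | (k <= j)%N) ('X^j * (1 - 'X) ^+ (n - j)) *+ 'C(n, j).

(** Descending induction from k = n. The term j = k has a derivative with two parts; the negative
    one cancels the derivative of the tail from k+1 because (k+1) C(n,k+1) = (n-k) C(n,k). *)
Lemma deriv_binomial_tail n k : (0 < k <= n)%N ->
  (binomial_tail n k)^`()%R = ('X^(k.-1) * (1 - 'X) ^+ (n - k)) *+ (k * 'C(n, k)).
Proof.
move=> /andP[]; move: {2}(n - k)%N (erefl (n - k)%N) => m.
elim: m k => [|m IHm] k nk k0 kn.
  have -> : k = n by apply/eqP; rewrite eqn_leq kn -subn_eq0 nk.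
  rewrite /binomial_tail (big_pred1 ord_max) => [|j].
    by rewrite /= subnn expr0 !mulr1 binn muln1 mulr1n derivXn.
  by rewrite /= -val_eqE/= eqn_leq (leq_ord j).
have {}kn : (k < n)%N by rewrite -subn_gt0 nk.
have -> : binomial_tail n k =
    ('X^k * (1 - 'X) ^+ (n - k)) *+ 'C(n, k) + binomial_tail n k.+1.
  rewrite /binomial_tail (bigD1 (Ordinal (ltn_trans kn (ltnSn n))))//=; congr (_ + _).
  by apply: eq_bigl => j; rewrite ltn_neqAle andbC eq_sym -val_eqE.
rewrite derivD IHm//; last by rewrite subnS nk.
rewrite mul_bin_left/= derivMn derivM derivXn deriv_exp derivB derivC derivX sub0r.
rewrite subnS.
move: ('X^(k.-1)) ('X^k) ((1 - 'X) ^+ (n - k)) ((1 - 'X) ^+ (n - k).-1) => a b c e.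
by rewrite mulN1r mulNrn mulrN mulrnAl mulrnAr !mulrnA mulrnBl subrK.
Qed.

(** Identifies the constant of the differentiated tail with the normalization of the Beta
    density. *)
Lemma beta_funV n k : (0 < k <= n)%N ->
  (beta_fun k (n.+1 - k))^-1%R = (k * 'C(n, k))%:R :> R.
Proof.
move=> /andP[k0 kn]; rewrite beta_funE subSn// (gtn_eqF k0)/=.
rewrite addnS subnKC//= invf_div -natrM.
apply: canLR (mulfK _) _; first by rewrite pnatr_eq0 -lt0n muln_gt0 !fact_gt0.
rewrite -natrM; congr (_%:R).
by rewrite -(bin_fact kn) -[in k`!](prednK k0) factS prednK// -mulnA mulnCA mulnA.
Qed.

Lemma beta_prob_itv n k t : (0 < k <= n)%N -> (0 <= t <= 1)%R ->
  beta_prob k (n.+1 - k) `]-oo, t]%classic = ((binomial_tail n k).[t])%:E :> \bar R.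
Proof.
move=> kn /andP[t0 t1].
(* The boundary term at 0 vanishes since every summand contains a power of ['X] with exponent at
   least k > 0. *)
have tail0 : (binomial_tail n k).[0]%R = 0%R.
  rewrite /binomial_tail horner_sum big1// => j kj; rewrite hornerMn hornerM hornerXn.
  by rewrite expr0n (gtn_eqF (leq_trans _ kj)) ?mul0r ?mul0rn//; case/andP: kn.
have -> : beta_prob k (n.+1 - k) `]-oo, t]%classic =
    (\int[lebesgue_measure]_(x in `[0%R, t]) ((binomial_tail n k)^`()%R.[x])%:E)%E.
  rewrite -integral_beta_pdf// /beta_pdf.
  rewrite integral_mkcond [RHS]integral_mkcond; apply: eq_integral => x _.
  rewrite !patchE !mem_setE !in_itv/= deriv_binomial_tail//.
  have [xt|] := leP x t; rewrite ?andbF// andbT.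
  have [x0|] := leP 0%R x => /=; last by rewrite mul0r.
  rewrite (le_trans xt t1) beta_funV// hornerMn hornerM hornerXn.
  rewrite horner_exp !hornerE mulr_natr; case/andP: kn => k0 kn.
  by rewrite subSn.
move: t0; rewrite le_eqVlt => /predU1P[<-|t0].
  by rewrite set_itv1 integral_set1 tail0.
rewrite (continuous_FTC2 (F := horner (binomial_tail n k)) t0).
- by rewrite tail0 sube0.
- exact/continuous_subspaceT/continuous_horner.
- split; first by move=> x _; exact: derivable_horner.
    by apply: cvg_at_right_filter; exact: continuous_horner.
  by apply: cvg_at_left_filter; exact: continuous_horner.
- by move=> x _; rewrite derivE.
Qed.

Lemma beta_prob_unique (Q : probability (measurableTypeR R) R) n k : (0 < k <= n)%N ->
  (forall x, (x < 0)%R -> Q `]-oo, x]%classic = 0%E) ->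
  (forall x, (0 <= x < 1)%R -> Q `]-oo, x]%classic = ((binomial_tail n k).[x])%:E) ->
  (forall x, (1 <= x)%R -> Q `]-oo, x]%classic = 1%E) ->
  forall B, measurable B -> Q B = beta_prob k (n.+1 - k) B.
Proof.
move=> kn Q0 Q01 Q1.
(* All the Beta mass lies in [0, 1], which settles the half-lines ending outside that interval. *)
have beta01 := @beta_prob01 R k (n.+1 - k).
have QE x : Q `]-oo, x]%classic = beta_prob k (n.+1 - k) `]-oo, x]%classic.
  have [x0|x0] := ltP x 0%R.
    rewrite Q0//; apply/esym/eqP; rewrite eq_le measure_ge0 andbT.
    rewrite (le_trans (y := beta_prob k (n.+1 - k) (~` `[0%R, 1%R]%classic)))//.
      apply: le_measure; rewrite ?inE//; first exact: measurableC.
      by move=> y; rewrite /= !in_itv/= => yx; rewrite leNgt (le_lt_trans yx x0).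
    by rewrite probability_setC// [X in (_ - X)%E]beta01 subee.
  have [x1|x1] := ltP x 1%R; first by rewrite Q01 ?x0// beta_prob_itv// x0 ltW.
  rewrite Q1//; apply/eqP; rewrite eq_le probability_le1// andbT -[leLHS]beta01.
  apply: le_measure; rewrite ?inE// => y; rewrite /= !in_itv/= => /andP[_ y1].
  exact: le_trans x1.
have ocE (a b : R) : (a <= b)%R ->
    `]a, b]%classic = `]-oo, b]%classic `\` `]-oo, a]%classic :> set R.
  move=> ab; apply/seteqP; split=> y; rewrite /= !in_itv/= -?ltNge.
    by move=> /andP[ay yb]; split=> //; apply/negP; rewrite -ltNge.
  by move=> [-> /negP]; rewrite -ltNge => ->.
move=> B mB.
apply: (@measure_unique _ R (measurableTypeR R) (@ocitv R)
  (fun i => `](- i%:R)%R, i%:R]%classic) _ _ _ _ Q (@beta_prob R k (n.+1 - k))) => //.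
- exact: ocitvI.
- by move=> i; exact: is_ocitv.
- rewrite -subTset => x _; exists (Num.truncn `|x|).+1 => //=; rewrite in_itv/=.
  have := truncnS_gt `|x|; rewrite ltr_norml => /andP[-> /ltW ->] //.
- move=> _ [[a b] _ <-]/=; have [ab|ba] := leP a b; last first.
    by rewrite set_itv_ge ?measure0// bnd_simp -leNgt ltW.
  rewrite ocE// !measureD//; last 2 first.
  + by rewrite (le_lt_trans (probability_le1 _ _))// ltry.
  + by rewrite (le_lt_trans (probability_le1 _ _))// ltry.
  rewrite setIidr; last by move=> y; rewrite /= !in_itv/= => /le_trans; exact.
  by congr (_ - _)%E; exact: QE.
- by move=> i; rewrite (le_lt_trans (probability_le1 _ _))// ltry.
Qed.

End beta_distribution_function.

(** * Quantiles of an atomless law *)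

Section quantile.
Context (dO : measure_display) (Omega : measurableType dO) (R : realType).
Variables (P : probability Omega R) (Y : Omega -> \bar R).
Hypothesis mY : measurable_fun setT Y.
Hypothesis Y_ge0 : forall w, 0 <= Y w.
Hypothesis Y_atomless : atomless_law P Y.

Let F (y : \bar R) := P [set w | Y w <= y].

Let mYle y : measurable [set w | Y w <= y].
Proof. by rewrite -[X in measurable X]setTI; exact: emeasurable_fun_infty_c. Qed.

Let mYlt y : measurable [set w | Y w < y].
Proof. by rewrite -[X in measurable X]setTI; exact: emeasurable_fun_infty_o. Qed.

Let mYeq y : measurable [set w | Y w = y].
Proof. by rewrite -[X in measurable X]setTI; exact: (mY measurableT (emeasurable_set1 y)). Qed.

Let F_nd : {homo F : x y / x <= y}.
Proof.
move=> x y xy; apply: le_measure; rewrite ?inE//.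
by move=> w /= wx; exact: le_trans xy.
Qed.

Let F_lt y : F y = P [set w | Y w < y].
Proof.
apply/eqP; rewrite eq_le; apply/andP; split; last first.
  by apply: le_measure; rewrite ?inE// => w /= /ltW.
apply: (@le_trans _ _ (P ([set w | Y w < y] `|` [set w | Y w = y]))).
  apply: le_measure; rewrite ?inE//; first exact: measurableU.
  by move=> w /=; rewrite le_eqVlt => /predU1P[|]; [right|left].
apply: (le_trans (measureU2 _ _ _)) => //.
by rewrite -[leRHS]adde0 leeD2l// -(Y_atomless y).
Qed.

(** Left continuity of [F], along any sequence cofinal below [y]. It is applied at [+oo] as well as
    at a real point. *)
Let F_le_of_lt (t : R) (u : nat -> \bar R) y : (forall n, F (u n) <= t%:E) ->
  nondecreasing_seq u -> (forall x, x < y -> exists n, x <= u n) -> F y <= t%:E.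
Proof.
move=> ut und uy; rewrite F_lt.
pose B n := [set w | Y w <= u n].
have ndB : nondecreasing_seq B.
  by move=> i j ij; apply/subsetPset => w /= /le_trans; apply; exact: und.
apply: (@le_trans _ _ (P (\bigcup_n B n))).
  apply: le_measure; rewrite ?inE//; first by apply: bigcup_measurable => n _; exact: mYle.
  by move=> w /= Yw; have [n Yu] := uy _ Yw; exists n.
have /cvg_lim <- // : P \o B @ \oo --> P (\bigcup_n B n).
  apply: nondecreasing_cvg_mu => //; first by move=> n; exact: mYle.
  by apply: bigcup_measurable => n _; exact: mYle.
apply: lime_le; last by apply: nearW => n; exact: ut.
apply: ereal_nondecreasing_is_cvgn => i j ij /=.
by apply: le_measure; rewrite ?inE; [exact: mYle|exact: mYle|exact/subsetPset/ndB].
Qed.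

Let F_ge_of_gt (t c : R) : (forall x : R, (c < x)%R -> t%:E < F x%:E) -> t%:E <= F c%:E.
Proof.
move=> ct; pose B n := [set w | Y w <= (c + n.+1%:R^-1)%:E].
have niB : nonincreasing_seq B.
  move=> i j ij; apply/subsetPset => w /= /le_trans; apply.
  by rewrite lee_fin lerD2l lef_pV2 ?posrE// ler_nat.
have BE : \bigcap_n B n = [set w | Y w <= c%:E].
  apply/seteqP; split=> w /=.
    move=> Bw; apply/lee_addgt0Pr => e e0.
    have [n _ /(_ n (leqnn n)) ne] := near_infty_natSinv_lt (PosNum e0).
    by apply: (le_trans (Bw n I)); rewrite lee_fin lerD2l ltW.
  by move=> Yc n _; apply: (le_trans Yc); rewrite lee_fin lerDl.
rewrite /F -BE.
have /cvg_lim <- // : P \o B @ \oo --> P (\bigcap_n B n).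
  apply: nonincreasing_cvg_mu => //.
  - by apply: (@le_lt_trans _ _ 1); [apply: probability_le1; exact: mYle|exact: ltry].
  - by move=> n; exact: mYle.
  - by rewrite BE; exact: mYle.
apply: lime_ge; last by apply: nearW => n; apply/ltW/ct; rewrite ltrDl.
apply: ereal_nonincreasing_is_cvgn => i j ij /=.
by apply: le_measure; rewrite ?inE; [exact: mYle|exact: mYle|exact/subsetPset/niB].
Qed.

(** [c] is the largest [t]-quantile: [F] may be flat at level [t], and a smaller quantile would
    break the equivalence. Continuity of [F] makes the supremum attained with value exactly [t]. *)
Lemma atomless_quantile (t : R) : (0 <= t < 1)%R -> exists c : R,
  P [set w | Y w <= c%:E] = t%:E /\
  forall y, (P [set w | Y w <= y] <= t%:E) = (y <= c%:E).
Proof.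
move=> /andP[t0 t1]; pose A := [set r : R | F r%:E <= t%:E].
have A0 : A (-1)%R.
  rewrite /A/= /F (_ : [set w | _] = set0) ?measure0 ?lee_fin//.
  apply/seteqP; split=> w //= /(le_trans (Y_ge0 w)).
  by rewrite lee_fin lerNr oppr0 ler10.
(* If every integer were in [A], then [F +oo] would be at most [t], because atomlessness also
   excludes mass at [+oo]; but [F +oo] is 1 and t < 1. *)
have [n nA] : exists n : nat, ~ A n%:R.
  apply: contrapT => /forallNP/= allA.
  have : F +oo <= t%:E.
    apply: (@F_le_of_lt t (fun n => n%:R%:E)).
    - by move=> n; exact: contrapT (allA n).
    - by move=> i j ij; rewrite lee_fin ler_nat.
    - move=> [x _| |_]; last by exists 0%N; rewrite leNye.
        by exists (Num.truncn `|x|).+1; rewrite lee_fin (le_trans (ler_norm x))// ltW// truncnS_gt.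
      by rewrite ltxx.
  rewrite /F (_ : [set w | _] = setT) ?probability_setT ?lee_fin 1?leNgt ?t1//.
  by apply/seteqP; split=> w //= _; exact: leey.
have hA : has_sup A.
  split; first by exists (-1)%R.
  exists n%:R => r Ar; rewrite leNgt; apply/negP => nr; apply: nA.
  by apply: le_trans Ar; apply: F_nd; rewrite lee_fin ltW.
pose c := sup A; exists c.
have gtc x : (c < x)%R -> t%:E < F x%:E.
  move=> cx; rewrite ltNge; apply/negP => Ax.
  by have := ub_le_sup hA.2 Ax; rewrite leNgt cx.
have ltc x : (x < c)%R -> F x%:E <= t%:E.
  move=> xc; have [r Ar xr] := sup_gt hA.1 xc.
  by apply: le_trans Ar; apply: F_nd; rewrite lee_fin ltW.
have Fc : F c%:E = t%:E.
  apply/eqP; rewrite eq_le F_ge_of_gt// andbT.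
  apply: (@F_le_of_lt t (fun n => (c - n.+1%:R^-1)%:E)).
  - by move=> m; apply: ltc; rewrite ltrBlDr ltrDl.
  - by move=> i j ij; rewrite lee_fin lerD2l lerN2 lef_pV2 ?posrE// ler_nat.
  - move=> [x| |_]; [|by []|by exists 0%N; rewrite leNye].
    rewrite lte_fin -subr_gt0 => xc.
    have [m _ /(_ m (leqnn m))/ltW xm] := near_infty_natSinv_lt (PosNum xc).
    by exists m; rewrite lee_fin lerBrDr addrC -lerBrDr.
split=> // y; apply/idP/idP => [|/F_nd]; last by rewrite Fc.
apply: contraTT; rewrite -!ltNge; case: y => [y|_|//].
  by rewrite lte_fin => /gtc.
apply: (@lt_le_trans _ _ (F (c + 1)%:E)); first by apply: gtc; rewrite ltrDl.
by apply: F_nd; exact: leey.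
Qed.

End quantile.

(** * The threshold of an i.i.d. sample *)

Section iid_threshold.
Context (dO : measure_display) (Omega : measurableType dO) (R : realType).
Variable P : probability Omega R.
Context (dT : measure_display) (T : measurableType dT) (n k : nat).
Variables (X : 'I_n.+1 -> Omega -> T) (s : T -> \bar R).
Hypothesis mX : forall i, measurable_fun setT (X i).
Hypothesis ms : measurable_fun setT s.
Hypothesis s_ge0 : forall a, 0 <= s a.
Hypothesis k_gt0 : (0 < k)%N.
Hypothesis k_le : (k <= n.+1)%N.
Hypothesis indep : mutually_independent P X.
Hypothesis same_law : forall i j B, measurable B -> P (X i @^-1` B) = P (X j @^-1` B).
Hypothesis atomless : forall i, atomless_law P (fun w => s (X i w)).

Let prev i := X (widen_ord (leqnSn n) i).

Let mXs i : measurable_fun setT (fun w => s (X i w)).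
Proof. exact: (measurableT_comp ms (mX i)). Qed.

(** The event is split by the exact set [J] of successes. Independence gives each piece a
    probability depending only on the size of [J], and there are C(n,j) sets of size j. *)
Lemma probability_count (B : set T) (p : R) : measurable B ->
  (forall i, P (X i @^-1` B) = p%:E) ->
  P [set w | (k <= #|[set i : 'I_n | prev i w \in B]%SET|)%N] = ((binomial_tail R n k).[p])%:E.
Proof.
move=> mB PB.
pose C (J : {set 'I_n}) i := if i \in J then B else ~` B.
pose A (J : {set 'I_n}) := \bigcap_i prev i @^-1` C J i.
have mC J i : measurable (C J i) by rewrite /C; case: ifP => // _; exact: measurableC.
have mA J : measurable (A J).
  by apply: fin_bigcap_measurable => // i _; rewrite -[X in measurable X]setTI; exact: mX.
have AP J w : A J w <-> J = [set i : 'I_n | prev i w \in B]%SET.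
  split=> [Aw|-> i _]; last first.
    rewrite /C /= finset.in_set; case: ifPn => [|]; first exact: set_mem.
    by rewrite notin_setE.
  apply/setP => i; rewrite finset.in_set; have := Aw i I; rewrite /C /=.
  by case: ifPn => _ ?; apply/esym; [exact: mem_set|apply/negbTE; rewrite notin_setE].
have PA J : P (A J) = (p ^+ #|J| * (1 - p) ^+ (n - #|J|))%:E.
  have := independent_rectangle indep (mC J) measurableT.
  rewrite preimage_setT setIT probability_setT mule1 => ->.
  have PC i : P (X (widen_ord (leqnSn n) i) @^-1` C J i) =
      (if i \in J then p else 1 - p)%:E.
    rewrite /C; case: ifP => _; first exact: PB.
    rewrite preimage_setC probability_setC ?PB//.
    by rewrite -[X in measurable X]setTI; exact: mX.
  under eq_bigr do rewrite PC.
  rewrite prodEFin; congr EFin; rewrite (bigID (fun i => i \in J))/=.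
  rewrite (eq_bigr (fun=> p)); last by move=> i ->.
  rewrite [X in (_ * X)%R](eq_bigr (fun=> 1 - p)%R); last by move=> i /negbTE ->.
  rewrite !prodr_const; congr (_ * _ ^+ _)%R.
  have := cardsC J; rewrite card_ord => /(congr1 (subn^~ #|J|)); rewrite addKn => <-.
  by apply: eq_card => i; rewrite finset.in_setC.
pose D : {pred {set 'I_n}} := fun J => (k <= #|J|)%N.
have -> : [set w | (k <= #|[set i : 'I_n | prev i w \in B]%SET|)%N] =
    \bigcup_(J in [set` D]) A J.
  apply/seteqP; split=> w; first by move=> kw; eexists; [exact: kw|exact/AP].
  by move=> [J DJ /AP JE]; move: DJ; rewrite JE.
rewrite measure_fin_bigcup//; last first.
  by move=> J J' _ _ [w [/AP -> /AP ->]].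
rewrite -(bigfs _ (r := index_enum _)) ?index_enum_uniq//; last first.
  by move=> J _; rewrite mem_index_enum.
rewrite (eq_bigr _ (fun J _ => PA J)).
rewrite sumEFin; congr EFin.
rewrite (partition_big (fun J : {set 'I_n} => inord #|J| : 'I_n.+1)
  (fun j : 'I_n.+1 => (k <= j)%N)); last first.
  by move=> J; rewrite inordK// ltnS -[leqRHS](card_ord n) max_card.
rewrite /binomial_tail horner_sum; apply: eq_bigr => j kj.
rewrite hornerMn hornerM hornerXn horner_exp !hornerE.
rewrite (eq_bigr (fun=> p ^+ j * (1 - p) ^+ (n - j)))%R; last first.
  by move=> J /andP[_ /eqP <-]; rewrite inordK// ltnS -[leqRHS](card_ord n) max_card.
rewrite sumr_const; congr (_ *+ _)%R.
have := card_draws 'I_n j; rewrite card_ord => <-; apply: eq_card => J.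
rewrite [in RHS]finset.in_set unfold_in /= /D -val_eqE/= inordK; last first.
  by rewrite ltnS -[leqRHS](card_ord n) max_card.
by case: eqP => [->|]; rewrite ?kj ?andbF.
Qed.

Let prefix : set (set Omega) := \big[setU/set0]_(i < n)
  preimage_set_system setT (prev i) measurable.

Let prefixm : prefix `<=` measurable. Proof. exact: prefix_measurable. Qed.

Let measurable_prev i :
  measurable_fun setT (fun w : g_sigma_algebraType prefix => s (prev i w)).
Proof.
move=> _ B mB; rewrite setTI; apply: sub_sigma_algebra.
apply: (@prefix_preimage _ _ _ _ _ X i (s @^-1` B)).
by rewrite -[X in measurable X]setTI; exact: ms.
Qed.

Let lambda w := threshold k (fun i => s (X i w)).

(** Measurability is over the sigma-algebra of the first [n] variables, as a version of the
    conditional probability requires. *)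
Lemma measurable_threshold :
  measurable_fun setT (lambda : g_sigma_algebraType prefix -> \bar R).
Proof.
have [kn|nk] := leqP k n; last first.
  rewrite (_ : lambda = cst +oo); first exact: measurable_cst.
  by apply/funext => w; rewrite /lambda /threshold leqNgt nk.
apply: (measurability (@ErealGenOInfty.G R)); first exact: ErealGenOInfty.measurableE.
move=> _ [_ [r ->] <-]; rewrite setTI.
rewrite (_ : _ @^-1` _ = [set w : g_sigma_algebraType prefix |
    (#|[set i : 'I_n | (s (prev i w) <= r%:E)%E]%SET| < k)%N]).
  by apply: (@measurable_rank R (fun a b => a <= b) (@measurable_leE R) _
    (g_sigma_algebraType prefix) _ (fun i w => s (prev i w)) (cst r%:E)).
by apply/seteqP; split=> w; rewrite /= in_itv/= andbT ltNge threshold_le// -ltnNge.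
Qed.

Let F (y : \bar R) := P [set w | s (X ord_max w) <= y].

Let Fle y : measurable [set w | s (X ord_max w) <= y].
Proof. by rewrite -[X in measurable X]setTI; exact: emeasurable_fun_infty_c. Qed.

Let F_fin y : F y \is a fin_num. Proof. by rewrite fin_num_measure. Qed.

Definition coverage_probability (w : Omega) : R := fine (F (lambda w)).

Let Z_ge0 w : (0 <= coverage_probability w)%R. Proof. exact: fine_ge0. Qed.

Let Z_le1 w : (coverage_probability w <= 1)%R.
Proof. by rewrite -lee_fin fineK// probability_le1. Qed.

Let mS_indep G B : <<s prefix >> G -> measurable B ->
  P (G `&` (fun w => s (X ord_max w)) @^-1` B) =
  P G * P ((fun w => s (X ord_max w)) @^-1` B).
Proof.
move=> mG mB; apply: (independent_prefix mX indep mG (B := s @^-1` B)).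
by rewrite -[X in measurable X]setTI; exact: ms.
Qed.

Let Q := [set p : g_sigma_algebraType prefix * \bar R | p.2 <= lambda p.1].

Let mQ : measurable Q.
Proof.
apply: measurable_leE; first exact: measurable_snd.
exact: (measurableT_comp measurable_threshold measurable_fst).
Qed.

Let measurable_Z :
  measurable_fun setT (coverage_probability : g_sigma_algebraType prefix -> R).
Proof.
exact: (measurableT_comp (fine_measurable (@measurableT _ (\bar R)))
  (measurable_independent_section P (mXs ord_max) mQ)).
Qed.

Lemma is_cond_prob_coverage : is_cond_prob P
  [set w | s (X ord_max w) <= lambda w] <<s prefix >> coverage_probability.
Proof.
have mZO : measurable_fun setT coverage_probability.
  exact: (measurableT_comp measurable_Z (measurable_coarsen prefixm)).
split.
- by move=> B mB; have := measurable_Z measurableT mB; rewrite setTI.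
- apply: (@le_integrable _ _ _ _ _ _ _ (cst 1)) => //.
  + exact/measurable_EFinP.
  + by move=> w _; rewrite /= lee_fin !ger0_norm.
  + exact: finite_measure_integrable_cst.
- move=> G mG; rewrite setIC.
  have := independent_section prefixm (mXs ord_max) mS_indep mQ mG.
  move=> ->; apply: eq_integral => w _; exact: fineK.
Qed.

Lemma coverage_probability_law (B : set R) : measurable B ->
  P (coverage_probability @^-1` B) = beta_law k (n.+1 - k) B.
Proof.
move=> mB; have mZO : measurable_fun setT coverage_probability.
  exact: (measurableT_comp measurable_Z (measurable_coarsen prefixm)).
rewrite /beta_law subn_eq0; have [nk|kn] := ltnP n k.
  have Z1 w : coverage_probability w = 1%R.
    rewrite /coverage_probability /lambda /threshold leqNgt nk/= /F.
    rewrite (_ : [set w | _] = setT) ?probability_setT//.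
    by apply/seteqP; split=> w' //= _; exact: leey.
  rewrite diracE; have [B1|B1] := boolP (1%R \in B).
    rewrite (_ : _ @^-1` _ = setT) ?probability_setT//.
    by apply/seteqP; split=> w //= _; rewrite Z1; exact: set_mem.
  rewrite (_ : _ @^-1` _ = set0) ?measure0//.
  by apply/seteqP; split=> w //=; rewrite Z1; move: B1; rewrite notin_setE.
have mZR : measurable_fun setT (coverage_probability : Omega -> measurableTypeR R).
  exact: mZO.
pose mfZ : {mfun Omega >-> measurableTypeR R} :=
  HB.pack coverage_probability (isMeasurableFun.Build _ _ _ _ _ mZR).
have kn' : (0 < k <= n)%N by rewrite k_gt0.
apply: (beta_prob_unique (Q := distribution P mfZ) kn') => // x.
- move=> x0; rewrite -[RHS](measure0 P); congr (P _); apply/seteqP; split=> w //=.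
  by rewrite in_itv/= leNgt (lt_le_trans x0).
- move=> x01.
  (* The quantile turns a bound on the conditional probability into a bound [c] on the threshold,
     and gives each trial success probability exactly [x]. *)
  have [c [Fc Fxc]] := atomless_quantile (mXs ord_max) (fun w => s_ge0 (X ord_max w))
    (atomless ord_max) x01.
  have mB' : measurable (s @^-1` [set y | y <= c%:E]).
    by rewrite -[X in measurable X]setTI; exact: emeasurable_fun_infty_c.
  rewrite -(probability_count mB' (p := x)); last first.
    by move=> i; rewrite (same_law i ord_max mB').
  congr (P _); apply/seteqP; split=> w /=; rewrite in_itv/= -lee_fin fineK// Fxc.
    rewrite threshold_le// => /leq_trans; apply; apply/subset_leq_card/fintype.subsetP => i.
    by rewrite !finset.inE => ?; exact: mem_set.
  move=> kw; rewrite threshold_le//; apply: (leq_trans kw).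
  apply/subset_leq_card/fintype.subsetP => i.
  by rewrite !finset.inE; exact: set_mem.
- move=> x1; rewrite -[RHS](probability_setT P); congr (P _); apply/seteqP; split=> w //= _.
  by rewrite in_itv/= (le_trans _ x1).
Qed.

Lemma threshold_no_tie :
  P [set w | (#|[set i | (s (X i w) < s (X ord_max w))%E]%SET| < k)%N] <=
  P [set w | (#|[set i | (s (X i w) <= s (X ord_max w))%E]%SET| <= k)%N].
Proof.
pose N i := [set w | s (prev i w) = s (X ord_max w)].
have mN i : measurable (N i).
  by rewrite -[X in measurable X]setTI; exact: measurable_eqe (mXs _) (mXs _).
(* With the first [n] variables frozen, a tie asks the last score to hit a fixed value, which has
   probability 0. *)
have PN i : P (N i) = 0.
  pose Qi := [set p : g_sigma_algebraType prefix * \bar R | s (prev i p.1) = p.2].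
  have mQi : measurable Qi.
    rewrite -[X in measurable X]setTI; apply: measurable_eqe => //.
    exact: (measurableT_comp (measurable_prev i) measurable_fst).
  have := independent_section prefixm (mXs ord_max) mS_indep mQi
    (@measurableT _ (g_sigma_algebraType prefix)).
  rewrite setTI => ->; apply: integral0_eq => w _.
  rewrite -[RHS](atomless ord_max (s (prev i w))); congr (P _).
  by apply/seteqP; split=> w'.
have [mU PU] : measurable (\big[setU/set0]_i N i) /\ P (\big[setU/set0]_i N i) = 0.
  elim/big_ind : _ => [|A A' [mA PA] [mA' PA']|i _]; [by rewrite measure0|split|by []].
    exact: measurableU.
  apply/eqP; rewrite eq_le measure_ge0 andbT.
  by rewrite (le_trans (measureU2 _ mA mA'))// -[leRHS]adde0 -{1}PA -PA'.
set E := (X in P X <= _); set E' := (X in _ <= P X).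
have mE : measurable E by exact: (measurable_rank_lt mX ms).
have mE' : measurable E' by exact: (measurable_rank_le mX ms k.+1).
apply: (@le_trans _ _ (P (E' `|` \big[setU/set0]_i N i))).
  apply: le_measure; rewrite ?inE//; first exact: measurableU.
  move=> w Ew; have [|noN] := pselect ((\big[setU/set0]_i N i) w); [by right|left].
  (* Without ties, the weak rank exceeds the strict rank only by the last index itself. *)
  apply: leq_trans (_ : (#|ord_max |: [set i | (s (X i w) < s (X ord_max w))%E]|%SET <= _)%N).
    apply/subset_leq_card/fintype.subsetP => i; rewrite !finset.inE.
    rewrite le_eqVlt => /orP[/eqP Siw|->]; last by rewrite orbT.
    have [j|->] := unliftP ord_max i; last by rewrite eqxx.
    move=> ij; case: noN; rewrite -bigcup_seq; exists j; first by rewrite /= mem_index_enum.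
    by rewrite /N /= /prev -Siw ij; congr (s (X _ w)); apply/val_inj; exact: esym (lift_max j).
  by rewrite cardsU1 (leq_trans (leq_add (leq_b1 _) (leqnn _)))// add1n.
by rewrite (le_trans (measureU2 _ mE' mU))// -[leRHS]adde0 -{1}PU.
Qed.

End iid_threshold.

(** * Coverage, containment and rank of the last score as one event *)

Theorem theorem2p3 (R : realType) (d da du : nat) (D : domain R d)
  (A : function_space D 'rV[R]_da) (U : function_space D 'rV[R]_du)
  (U1 : function_space D R^o)
  (Gdag Ghat : A -> U) (Ehat : A -> U1)
  (mGdag : measurable_fun [set: borel A] (Gdag : borel A -> borel U))
  (mGhat : measurable_fun [set: borel A] (Ghat : borel A -> borel U))
  (mEhat : measurable_fun [set: borel A] (Ehat : borel A -> borel U1))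
  (Ehat_ge0 : forall a, \forall x \ae @nu R d D, (0 <= fun_of (Ehat a) x :> R)%R)
  (gdag ghat : borel A * points D -> 'rV[R]_du)
  (ehat : borel A * points D -> R)
  (mgdag : measurable_fun [set: borel A * points D]
             (gdag : borel A * points D -> borel 'rV[R]_du))
  (mghat : measurable_fun [set: borel A * points D]
             (ghat : borel A * points D -> borel 'rV[R]_du))
  (mehat : measurable_fun [set: borel A * points D] ehat)
  (ehat_ge0 : forall p, (0 <= ehat p)%R)
  (gdagE : forall a : A, represents (fun x => gdag (a, x)) (Gdag a))
  (ghatE : forall a : A, represents (fun x => ghat (a, x)) (Ghat a))
  (ehatE : forall a : A, represents (fun x => ehat (a, x) : R^o) (Ehat a))
  (mu : probability (borel A) R)
  (alpha gamma : R) (halpha : (0 < alpha < 1)%R) (hgamma : (0 < gamma < 1)%R)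
  (n k : nat) (hn : (1 <= n)%N)
  (hk : k%:Z = Num.ceil ((1 - alpha) * n.+1%:R)%R)
  (dO : measure_display) (Omega : measurableType dO) (P : probability Omega R)
  (X : 'I_n.+1 -> {RV P >-> borel A})
  (law_X : forall i (B : set (borel A)), measurable B ->
             distribution P (X i) B = mu B)
  (exch_X : exchangeable P (fun i => X i : Omega -> borel A)) :
  let s := score gdag ghat ehat gamma in
  let lambda_hat := fun w : Omega => threshold k (fun i => s (X i w)) in
  let covered := [set w | (1 - gamma)%:E <=
        coverage gdag ghat ehat (lambda_hat w) (X ord_max w)] in
  let contained := [set w | (1 - gamma)%:E <=
        containment gdag ghat ehat (lambda_hat w) (X ord_max w)] in
  let sigma_n := g_sigma_preimage
        (fun i : 'I_n => X (widen_ord (leqnSn n) i) : Omega -> borel A) in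
  [/\ measurable covered,
      (k%:R / n.+1%:R)%:E <= P covered
    & (1 - alpha <= k%:R / n.+1%:R)%R] /\
  (mutually_independent P (fun i => X i : Omega -> borel A) ->
   atomless_law P (fun w => s (X ord0 w)) ->
   [/\ measurable contained,
       exists Z, is_cond_prob P contained sigma_n Z,
       forall Z, is_cond_prob P contained sigma_n Z ->
         forall B : set R, measurable B ->
           P (Z @^-1` B) = beta_law k (n.+1 - k) B,
       P covered = (k%:R / n.+1%:R)%:E
     & (k%:R / n.+1%:R <= 1 - alpha + n.+1%:R^-1)%R]).
Proof.
move=> s lambda_hat covered contained sigma_n.
have s_ge0 a : 0 <= s a by exact: score_ge0.
have gamma0 : (0 < gamma)%R by case/andP: hgamma.
have ms : measurable_fun setT s by exact: measurable_score.
have mX i : measurable_fun setT (X i : Omega -> borel A) by exact: measurable_funPT.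
have k_lower : ((1 - alpha) * n.+1%:R <= k%:R)%R.
  by have := ceil_ge ((1 - alpha) * n.+1%:R)%R; rewrite -hk.
have k_upper : (k%:R < (1 - alpha) * n.+1%:R + 1)%R.
  by have := ceilB1_lt ((1 - alpha) * n.+1%:R)%R; rewrite -hk intrB ltrBlDr.
have [/andP[alpha0 alpha1] n0] : (0 < alpha < 1)%R /\ (0 < n.+1%:R :> R)%R by split.
have k_gt0 : (0 < k)%N.
  by rewrite -(ltr_nat R) (lt_le_trans _ k_lower)// mulr_gt0// subr_gt0.
(* As [alpha] is positive, the ceiling is below n+2; the value n+1 remains possible and yields the
   infinite threshold. *)
have k_le : (k <= n.+1)%N.
  rewrite -ltnS -(ltr_nat R) -natr1 (lt_le_trans k_upper)// lerD2r.
  by rewrite ler_piMl ?(ltW n0)//; lra.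
have lambda_ge0 w : 0 <= lambda_hat w by exact: threshold_ge0.
have containedE : contained = [set w | s (X ord_max w) <= lambda_hat w].
  by apply/seteqP; split=> w; rewrite /contained/= -score_le.
have coveredE : covered = contained.
  by apply/seteqP; split=> w; rewrite /covered/contained/= coverage_containment.
have rankE : covered =
    [set w | (#|[set i | (s (X i w) < s (X ord_max w))%E]%SET| < k)%N].
  by rewrite coveredE containedE; apply/seteqP; split=> w; rewrite /= le_threshold.
have mcovered : measurable covered by rewrite rankE; exact: measurable_rank_lt mX ms _ _.
have covered_ge : (k%:R / n.+1%:R)%:E <= P covered.
  by rewrite rankE; exact: exchangeable_rank_lt.
split; first by split=> //; rewrite ler_pdivlMr.
move=> indep atomless0.
have same_law i j B : measurable B -> P (X i @^-1` B) = P (X j @^-1` B).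
  by move=> mB; have := law_X i B mB; rewrite -(law_X j B mB).
have atomless i : atomless_law P (fun w => s (X i w)).
  move=> t; rewrite -(atomless0 t).
  apply: (same_law i ord0 (s @^-1` [set t])).
  by have := ms measurableT _ (emeasurable_set1 t); rewrite setTI.
have cond := is_cond_prob_coverage mX ms k_gt0 indep.
split.
- by rewrite -coveredE.
- by eexists; rewrite containedE; exact: cond.
- move=> Z cZ B mB; rewrite containedE in cZ.
  rewrite (is_cond_prob_law_unique (prefix_measurable mX) cZ cond mB).
  exact: coverage_probability_law.
- apply/eqP; rewrite eq_le covered_ge andbT rankE.
  apply: le_trans (exchangeable_rank_le mX ms k exch_X).
  exact: threshold_no_tie.
- rewrite ler_pdivrMr// mulrDl mulVf ?gt_eqF//; exact: ltW.
Qed.
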